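(* Let $\lambda,\varepsilon,\sigma\in\mathbb{R}$ and $(x_0,y_0)\in\mathbb{R}^2\setminus\{(0,0)\}$. For a step size $0<\Delta t<1$, let $t_n=n\Delta t$ and let $\Delta B_{1,n}=B_1(t_{n+1})-B_1(t_n)$, where $B_1$ is a standard scalar Brownian motion on a complete probability space $(\Omega,\mathcal F,\mathbb P)$. Define the real sequence $\{\rho_n\}_{n\ge0}$ (the Milstein approximation of the modulus $|Z|$ of the solution of the system described in the context) by $\rho_0=\sqrt{x_0^2+y_0^2}$ and $$\rho_n=\rho_{n-1}\Big[1+\Big(\lambda+\tfrac{\varepsilon^2}{2}-\tfrac{\sigma^2}{2}\Big)\Delta t+\sigma\Delta B_{1,n-1}+\tfrac{\sigma^2}{2}\Delta B_{1,n-1}^2\Big],\quad n\ge1.$$ Then there exist $0<\Delta t_1<1$ and constants $C_1,C_2>0$ such that for all $0<\Delta t<\Delta t_1$, $$\lambda+\tfrac{\varepsilon^2}{2}+\tfrac{\sigma^2}{2}-C_1\Delta t\le\limsup_{n\to\infty}\frac{1}{t_n}\log\big[\mathbb E\rho_n^2\big]^{1/2}\le\lambda+\tfrac{\varepsilon^2}{2}+\tfrac{\sigma^2}{2}+C_1\Delta t,$$ and, almost surely, $$\lambda+\tfrac{\varepsilon^2}{2}-\tfrac{\sigma^2}{2}-C_2\Delta t^{1/2}\le\limsup_{n\to\infty}\frac{1}{t_n}\log|\rho_n|\le\lambda+\tfrac{\varepsilon^2}{2}-\tfrac{\sigma^2}{2}+C_2\Delta t^{1/2}.$$ Consequently, for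 all step sizes $0<\Delta t<\Delta t_1$: (a) if $\lambda+\frac{\varepsilon^2}{2}+\frac{\sigma^2}{2}<0$ then $\rho_n$ is mean-square exponentially stable, and if $\lambda+\frac{\varepsilon^2}{2}+\frac{\sigma^2}{2}>0$ then $\rho_n$ is mean-square exponentially blowing up; (b) if $\lambda+\frac{\varepsilon^2}{2}-\frac{\sigma^2}{2}<0$ then $\rho_n$ is almost-surely exponentially stable, and if $\lambda+\frac{\varepsilon^2}{2}-\frac{\sigma^2}{2}>0$ then $\rho_n$ is almost-surely exponentially blowing up.
   Context: The sequence $\rho_n$ is the Milstein approximation (denoted $|Z_n|$ in the paper) of the Euclidean norm $|Z(t)|$ of the solution $Z=(X,Y)^\top$ of the linear system $dZ=\lambda Z\,dt+\sigma Z\,dB_1(t)+\varepsilon\begin{pmatrix}0&-1\\1&0\end{pmatrix}Z\,dB_2(t)$, $Z(0)=(x_0,y_0)$, with $B_1,B_2$ standard scalar Brownian motions; by Itô's formula $d\log|Z|=(\lambda-\frac{\sigma^2-\varepsilon^2}{2})dt+\sigma dB_1$. Terminology: $\rho_n$ is mean-square exponentially stable if there exist $C,\alpha>0$ with $[\mathbb E\rho_n^2]^{1/2}\le Ce^{-\alpha t_n}$ for all large $n$, and mean-square exponentially blowing up if there exist $C,\beta>0$ with $[\mathbb E\rho_n^2]^{1/2}\ge Ce^{\beta t_n}$ for all large $n$; almost-surely exponentially stable (resp. blowing up) means that almost surely $|\rho_n|\le Ce^{-\alpha t_n}$ (resp. $|\rho_n|\ge Ce^{\beta t_n}$) for all large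 $n$, for some $\alpha>0$ (resp. $\beta>0$) and a (possibly random) constant $C>0$. $\Delta t_1$ and the constants may depend on $\lambda,\varepsilon,\sigma$. *)

(* Defs.v *)
From HB Require Import structures.
From mathcomp Require Import all_boot all_order all_algebra.
From mathcomp Require Import all_classical all_reals all_analysis.
Set Implicit Arguments. Unset Strict Implicit. Unset Printing Implicit Defensive.
Import Order.TTheory GRing.Theory Num.Theory.
Import numFieldNormedType.Exports.
Local Open Scope classical_set_scope.
Local Open Scope ring_scope.

Definition is_brownian d (T : measurableType d) (R : realType)
    (P : probability T R) (B : R -> T -> R) : Prop :=
  [/\ (forall t, measurable_fun setT (B t)),
      {ae P, forall w, B 0 w = 0},
      {ae P, forall w, {within [set t : R | 0 <= t], continuous (fun t => B t w)}},
      (forall s t : R, 0 <= s -> s < t -> forall A : set R, measurable A ->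
          P [set w | B t w - B s w \in A] = normal_prob 0 (Num.sqrt (t - s)) A) &
      (forall (n : nat) (ts : nat -> R), 0 <= ts 0%N ->
          (forall i, (i < n)%N -> ts i < ts i.+1) ->
          forall A : nat -> set R, (forall i, measurable (A i)) ->
          P (\bigcap_(i in [set i | (i < n)%N])
               [set w | B (ts i.+1) w - B (ts i) w \in A i]) =
          (\prod_(i < n) P [set w | (B (ts i.+1) w - B (ts i) w)%R \in A i])%E)].

Definition grid_time (R : realType) (dt : R) (n : nat) : R := n%:R * dt.

Definition bm_incr (R : realType) (T : Type) (B : R -> T -> R) (dt : R)
    (n : nat) (w : T) : R :=
  B (grid_time dt n.+1) w - B (grid_time dt n) w.

Fixpoint milstein_rho (R : realType) (T : Type) (lam eps sig x0 y0 dt : R)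
    (B : R -> T -> R) (n : nat) (w : T) : R :=
  match n with
  | 0%N => Num.sqrt (x0 ^+ 2 + y0 ^+ 2)
  | m.+1 => milstein_rho lam eps sig x0 y0 dt B m w *
      (1 + (lam + eps ^+ 2 / 2 - sig ^+ 2 / 2) * dt
         + sig * bm_incr B dt m w + sig ^+ 2 / 2 * (bm_incr B dt m w) ^+ 2)
  end.

Definition ms_norm d (T : measurableType d) (R : realType) (P : probability T R)
    (X : nat -> T -> R) (n : nat) : \bar R :=
  sqrte ('E_P[fun w => (X n w ^+ 2)%R])%E.

Definition ms_lyapunov d (T : measurableType d) (R : realType)
    (P : probability T R) (X : nat -> T -> R) (dt : R) : \bar R :=
  limn_esup (fun n => ((grid_time dt n)^-1)%:E * lne (ms_norm P X n))%E.

Definition path_lyapunov (R : realType) (x : nat -> R) (dt : R) : \bar R :=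
  limn_esup (fun n => ((grid_time dt n)^-1)%:E * lne (`|x n|)%:E)%E.

Definition ms_exp_stable d (T : measurableType d) (R : realType)
    (P : probability T R) (X : nat -> T -> R) (dt : R) : Prop :=
  exists C alpha : R, [/\ 0 < C, 0 < alpha &
    \forall n \near \oo,
      (ms_norm P X n <= (C * expR (- (alpha * grid_time dt n)))%:E)%E].

Definition ms_exp_blowup d (T : measurableType d) (R : realType)
    (P : probability T R) (X : nat -> T -> R) (dt : R) : Prop :=
  exists C beta : R, [/\ 0 < C, 0 < beta &
    \forall n \near \oo,
      ((C * expR (beta * grid_time dt n))%:E <= ms_norm P X n)%E].

Definition as_exp_stable d (T : measurableType d) (R : realType)
    (P : probability T R) (X : nat -> T -> R) (dt : R) : Prop :=
  exists alpha : R, 0 < alpha /\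
    {ae P, forall w, exists C : R, 0 < C /\
      \forall n \near \oo, `|X n w| <= C * expR (- (alpha * grid_time dt n))}.

Definition as_exp_blowup d (T : measurableType d) (R : realType)
    (P : probability T R) (X : nat -> T -> R) (dt : R) : Prop :=
  exists beta : R, 0 < beta /\
    {ae P, forall w, exists C : R, 0 < C /\
      \forall n \near \oo, C * expR (beta * grid_time dt n) <= `|X n w|}.

(* Main.v *)
(* Write h for the step size, r = sqrt h and F for the random one-step factor,
   so that rho_n = rho_0 F_0 ... F_(n-1) with the F_i i.i.d. functions of the
   normal increments. For small h the factor F is bounded below by 1/4.
   In mean square, E rho_n^2 = rho_0^2 (E F^2)^n, and E F^2 = 1 + 2 b h + O(h^2)
   with b = lam + eps^2/2 + sig^2/2.
   Almost surely, the strong law of large numbers is replaced by moments of the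
   small orders p = r and p = - r: with a = lam + eps^2/2 - sig^2/2 one has
   E F^p <= exp (p a h + K h^2), so that F_0^p ... F_(n-1)^p, divided by
   exp (n (p a h + (K + 1) h^2)), has a geometrically decaying expectation and
   is therefore almost surely bounded in n. Taking logarithms and dividing by p
   gives both bounds, with the error h^2 / r = r h per step. *)

Require Import Defs.
From HB Require Import structures.
From mathcomp Require Import all_boot all_order all_algebra.
From mathcomp Require Import all_classical all_reals all_analysis.
From mathcomp Require Import measurable_realfun.
From mathcomp Require Import ring lra.
Import Order.TTheory GRing.Theory Num.Theory.
Import numFieldNormedType.Exports.
Import HBNNSimple.
Set Implicit Arguments.
Unset Strict Implicit.
Local Open Scope classical_set_scope.
Local Open Scope ring_scope.

(** * Products of independent variables and almost sure bounds *)

(** The hypothesis on indicators says that [nu] is the image under [X] of the measure with density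
    [g]. Linearity extends it to simple functions, and monotone convergence to all nonnegative
    measurable [f]. Three instances are used below: conditioning on one coordinate of a product, a
    density ([X] the identity), and a reflection ([g] equal to 1). *)
Lemma integral_weighted_pushforward d d' (T : measurableType d)
    (T' : measurableType d') (R : realType) (mu : {measure set T -> \bar R})
    (nu : {measure set T' -> \bar R}) (g : T -> R) (X : T -> T') (f : T' -> R) :
  measurable_fun setT g -> (forall w, 0 <= g w) -> measurable_fun setT X ->
  (forall B, measurable B ->
    (\int[mu]_w (g w * \1_B (X w))%:E = nu B)%E) ->
  measurable_fun setT f -> (forall x, 0 <= f x) ->
  (\int[mu]_w (g w * f (X w))%:E = \int[nu]_x (f x)%:E)%E.
Proof.
move=> mg g0 mX gX mf f0.
have mEf : measurable_fun setT (fun x => (f x)%:E).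
  by apply/measurable_EFinP.
pose phi := nnsfun_approx measurableT mEf.
have phi_cvg x : (phi n x)%:E @[n --> \oo] --> (f x)%:E.
  by apply: cvg_nnsfun_approx => // y _; rewrite lee_fin.
have phi_nd x m n : (m <= n)%N -> phi m x <= phi n x.
  by move=> mn; have /lefP := nd_nnsfun_approx measurableT mEf mn; exact.
have mgphi n : measurable_fun setT (fun w => g w * phi n (X w)).
  by apply: measurable_funM => //; apply: measurableT_comp.
have simple n : (\int[mu]_w (g w * phi n (X w))%:E = \int[nu]_x (phi n x)%:E)%E.
  transitivity (\int[mu]_w (\sum_(y \in range (phi n))
      (y%:E * (g w * \1_(phi n @^-1` [set y]) (X w))%:E)))%E.
    apply: eq_integral => w _; rewrite [in LHS]fimfunE EFinM -fsumEFin//.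
    rewrite ge0_mule_fsumr; last by move=> y; exact: nnfun_muleindic_ge0.
    by apply: eq_fsbigr => y _; rewrite -!EFinM mulrCA.
  transitivity (\int[nu]_x (\sum_(y \in range (phi n))
      (y%:E * (\1_(phi n @^-1` [set y]) x)%:E)))%E; last first.
    apply: eq_integral => x _; rewrite [in RHS]fimfunE -fsumEFin//.
  have mgphi1 y : measurable_fun setT
      (fun w => (g w * \1_(phi n @^-1` [set y]) (X w))%:E).
    apply/measurable_EFinP/measurable_funM => //.
    by apply: measurableT_comp => //; exact: measurable_indic.
  have mphi1 y : measurable_fun setT (fun x => (\1_(phi n @^-1` [set y]) x : R)%:E).
    by apply/measurable_EFinP; exact: measurable_indic.
  rewrite !ge0_integral_fsum//; first last.
  - move=> y w _; rewrite -EFinM mulrCA EFinM mule_ge0 ?lee_fin//.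
    exact: nnfun_muleindic_ge0.
  - by move=> y; exact: measurable_funeM.
  - by move=> y x _; exact: nnfun_muleindic_ge0.
  - by move=> y; exact: measurable_funeM.
  apply: eq_fsbigr => y /[!inE] -[t _ <-].
  rewrite !ge0_integralZl ?lee_fin//; last first.
    by move=> w _; rewrite lee_fin mulr_ge0.
  by rewrite gX// integral_indic// setIT.
transitivity (limn (fun n => \int[mu]_w (g w * phi n (X w))%:E))%E.
  rewrite -monotone_convergence//.
  - apply: eq_integral => w _; apply/esym/cvg_lim => //.
    under eq_fun do rewrite EFinM.
    by rewrite EFinM; apply: cvgeZl => //; exact: phi_cvg.
  - by move=> n; exact/measurable_EFinP.
  - by move=> n w _; rewrite lee_fin mulr_ge0.
  - by move=> w _ m n mn; rewrite lee_fin ler_wpM2l// phi_nd.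
under eq_fun do rewrite simple.
rewrite -monotone_convergence//.
- by apply: eq_integral => x _; apply/cvg_lim => //; exact: phi_cvg.
- by move=> n; exact/measurable_EFinP.
- by move=> n x _; rewrite lee_fin.
- by move=> x _ m n mn; rewrite lee_fin phi_nd.
Qed.

(** Independence and the common law [nu] enter only through measurable rectangles, which is the form
    in which Brownian increments provide them. *)
Lemma integral_prod_iid d d' (T : measurableType d) (T' : measurableType d')
    (R : realType) (P : probability T R) (nu : probability T' R)
    (X : nat -> T -> T') (f : T' -> R) (c : R) (n : nat) :
  (forall i, measurable_fun setT (X i)) ->
  (forall A : nat -> set T', (forall i, measurable (A i)) ->
    P (\bigcap_(i in [set i | (i < n)%N]) (X i @^-1` A i)) =
    (\prod_(i < n) nu (A i))%E) ->
  measurable_fun setT f -> (forall x, 0 <= f x) ->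
  (\int[nu]_x (f x)%:E = c%:E)%E ->
  (\int[P]_w (\prod_(i < n) f (X i w))%:E = (c ^+ n)%:E)%E.
Proof.
move=> mX iid mf f0 fc.
have c0 : 0 <= c by rewrite -lee_fin -fc; apply: integral_ge0 => x _; rewrite lee_fin.
have nuE B : measurable B -> nu B = (fine (nu B))%:E.
  by move=> mB; rewrite fineK// fin_num_measure.
(* The indicators of an arbitrary measurable rectangle are replaced by f one
   coordinate at a time. *)
suff mixed k : (k <= n)%N -> forall A : nat -> set T', (forall i, measurable (A i)) ->
    (\int[P]_w (\prod_(i < n) (if (i < k)%N then f (X i w) else \1_(A i) (X i w)))%:E
     = (\prod_(i < n) (if (i < k)%N then c else fine (nu (A i))))%:E)%E.
  (* At [k = n] every factor is already [f], so the empty sets are mere placeholders. *)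
  have := mixed n (leqnn n) (fun=> set0) (fun=> measurable0).
  under eq_integral do under eq_bigr do rewrite ltn_ord.
  under eq_bigr do rewrite ltn_ord.
  by rewrite prodr_const card_ord.
elim: k => [_ A mA|k IH kn A mA].
  rewrite -prodEFin; under [RHS]eq_bigr do rewrite -nuE//.
  rewrite -iid//.
  have mcap : measurable (\bigcap_(i in [set i | (i < n)%N]) X i @^-1` A i).
    by apply: bigcap_measurableType => // i _; rewrite -[_ @^-1` _]setTI; exact: mX.
  rewrite -[in RHS](setIT (\bigcap_(_ in _) _)) -integral_indic//.
  apply: eq_integral => w _; congr EFin; rewrite indicE.
  case: (pselect ((\bigcap_(i in [set i | (i < n)%N]) X i @^-1` A i) w)) => wA.
    rewrite mem_set// big1//= => i _.
    by have := wA i (ltn_ord i); rewrite indicE => h; rewrite mem_set.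
  rewrite memNset//; move/existsNP : wA => [i /not_implyP[/= ni Aiw]].
  by rewrite (bigD1 (Ordinal ni))//= indicE memNset// mul0r.
pose k' := Ordinal kn.
have neqk (i : 'I_n) : i != k' -> (i < k.+1)%N = (i < k)%N.
  by rewrite -val_eqE/= ltnS leq_eqVlt => /negbTE ->.
under eq_integral do rewrite (bigD1 k')//= ltnSn mulrC.
rewrite (bigD1 k')//= ltnSn.
(* [g] collects the factors other than the [k]-th. Under the measure with density [g], the law of
   [X k] is [e] times [nu], which leaves a single integral of [f]. *)
pose g w := \prod_(i < n | i != k') (if (i < k.+1)%N then f (X i w) else \1_(A i) (X i w)).
pose e := \prod_(i < n | i != k') (if (i < k.+1)%N then c else fine (nu (A i))).
have e0 : 0 <= e by apply: prodr_ge0 => i _; case: ifP => _ //; exact: fine_ge0.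
rewrite (@integral_weighted_pushforward _ _ _ _ _ P (mscale (NngNum e0) nu) g (X k) f)//.
- rewrite ge0_integral_mscale//= ?fc; first by rewrite -EFinM mulrC.
  - exact/measurable_EFinP.
  - by move=> x _; rewrite lee_fin.
- have -> : g = fun w => \prod_(i < n) (if i != k' then
      (if (i < k.+1)%N then f (X i w) else \1_(A i) (X i w)) else 1).
    by apply/funext => w; rewrite /g big_mkcond.
  apply: measurable_prod => i _; case: (i != k') => //; case: (i < k.+1)%N.
    exact: measurableT_comp mf (mX i).
  by apply: measurableT_comp (mX i); exact: measurable_indic.
- by move=> w; apply: prodr_ge0 => i _; case: ifP.
- move=> B mB.
  (* Testing this weighted law on [B] is the induction hypothesis for the family of sets in which
     [A k] is replaced by [B]. *)
  have mAB i : measurable (if i == k then B else A i) by case: ifP.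
  transitivity ((e * fine (nu B))%:E)%E; last by rewrite EFinM -nuE.
  have neqB (i : 'I_n) : i != k' -> (i == k :> nat) = false.
    by rewrite -val_eqE/= => /negbTE.
  have -> : e * fine (nu B) = \prod_(i < n)
      (if (i < k)%N then c else fine (nu (if i == k :> nat then B else A i))).
    rewrite (bigD1 k')//= ltnn eqxx mulrC; congr (_ * _).
    by apply: eq_bigr => i ik; rewrite neqk// neqB.
  rewrite -(IH (ltnW kn) (fun i => if i == k then B else A i))//.
  apply: eq_integral => w _; congr EFin.
  rewrite [RHS](bigD1 k')//= ltnn eqxx mulrC; congr (_ * _).
  by apply: eq_bigr => i ik; rewrite neqk// neqB.
Qed.

(* The series of the Y_n has a finite integral, hence is a.e. finite, and it
   dominates each of its terms. *)
Lemma ae_bounded_geometric d (T : measurableType d) (R : realType)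
    (P : probability T R) (Y : nat -> T -> R) (K q : R) :
  (forall n, measurable_fun setT (Y n)) -> (forall n w, 0 <= Y n w) ->
  0 <= q < 1 ->
  (forall n, (\int[P]_w (Y n w)%:E <= (K * q ^+ n)%:E)%E) ->
  {ae P, forall w, exists C : R, 0 < C /\ forall n, Y n w <= C}.
Proof.
move=> mY Y0 /andP[q0 q1] YK.
pose S w := (\sum_(n <oo) (Y n w)%:E)%E.
have mS : measurable_fun setT S.
  apply: ge0_emeasurable_sum => [n w _ _|n _]; first by rewrite lee_fin.
  exact/measurable_EFinP.
have S0 w : (0 <= S w)%E by apply: nneseries_ge0 => n _ _; rewrite lee_fin.
have intS : (\int[P]_w S w < +oo)%E.
  rewrite integral_nneseries//; first last.
  - by move=> n w _; rewrite lee_fin.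
  - by move=> n; exact/measurable_EFinP.
  apply: (@le_lt_trans _ _ (\sum_(n <oo) (K * q ^+ n)%:E)%E).
    apply: lee_nneseries => n _ //.
    by move=> _; apply: integral_ge0 => w _; rewrite lee_fin.
  under eq_fun do rewrite sumEFin.
  rewrite EFin_lim ?ltry//.
  by apply: is_cvg_geometric_series; rewrite ger0_norm.
have : P.-integrable setT S.
  by apply/integrableP; split => //; under eq_integral do rewrite gee0_abs//.
move=> /(integrable_ae measurableT).
apply: filterS => w /(_ I) Sfin.
exists (fine (S w) + 1); split; first by rewrite ltr_wpDl// fine_ge0.
move=> n; rewrite -lee_fin EFinD fineK//.
apply: (@le_trans _ _ (S w)); last by rewrite leeDl// lee_fin.
rewrite /S (@nneseriesD1 _ _ n)//; last by move=> k _; rewrite lee_fin.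
by rewrite leeDl//; apply: nneseries_ge0 => k _ _; rewrite lee_fin.
Qed.

(** * Exponential remainders and moments of the normal law *)

(** Since [j! <= (n + j)!], the tail of the series from order [n] is dominated by |x|^n times the
    series of e^|x|. This is proved for partial sums and passed to the limit. *)
Lemma expR_taylor_bound (R : realType) (x : R) (n : nat) :
  `|expR x - \sum_(k < n) x ^+ k / k`!%:R| <= `|x| ^+ n * expR `|x|.
Proof.
have partial_le N : \sum_(j < N) `|x| ^+ j / j`!%:R <= expR `|x|.
  have nd : nondecreasing_seq (series (exp_coeff `|x|)).
    apply/nondecreasing_seqP => m; rewrite /series/= big_nat_recr//= lerDl.
    by rewrite divr_ge0// exprn_ge0.
  have := nondecreasing_cvgn_le nd (is_cvg_series_exp_coeff _) N.
  by rewrite /series/= big_mkord.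
have tail N : `|\sum_(k < n + N) x ^+ k / k`!%:R - \sum_(k < n) x ^+ k / k`!%:R|
    <= `|x| ^+ n * expR `|x|.
  rewrite big_split_ord/= addrAC subrr add0r.
  apply: (le_trans (ler_norm_sum _ _ _)).
  apply: le_trans (ler_wpM2l (exprn_ge0 _ (normr_ge0 x)) (partial_le N)).
  rewrite mulr_sumr; apply: ler_sum => j _.
  rewrite normrM normfV normrX exprD -mulrA ler_wpM2l ?exprn_ge0//.
  rewrite normr_nat ler_wpM2l ?exprn_ge0// lef_pV2 ?posrE ?ltr0n ?fact_gt0//.
  by rewrite ler_nat leq_fact// leq_addl.
have cv : (\sum_(k < n + N) x ^+ k / k`!%:R) @[N --> \oo] --> expR x.
  have := is_cvg_series_exp_coeff x; rewrite /series/=.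
  move/cvg_ex => [l]; rewrite /= => cl.
  have -> : expR x = l by exact: cvg_lim cl.
  under eq_fun do rewrite addnC -(big_mkord xpredT (fun k => x ^+ k / k`!%:R)).
  by move: cl; rewrite -(cvg_shiftn n).
have cvn : `|\sum_(k < n + N) x ^+ k / k`!%:R - \sum_(k < n) x ^+ k / k`!%:R| @[N --> \oo]
    --> `|expR x - \sum_(k < n) x ^+ k / k`!%:R|.
  by apply: cvg_norm; apply: cvgB => //; exact: cvg_cst.
rewrite -(cvg_lim _ cvn)//; apply: limr_le; first by apply/cvg_ex; eexists; exact: cvn.
exact: nearW.
Qed.

Lemma exprn_le_expR (R : realType) (x : R) (n : nat) :
  0 <= x -> x ^+ n <= n`!%:R * expR x.
Proof.
move=> x0; case: n => [|n]; first by rewrite mul1r -[leLHS]expR0 ler_expR.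
have := expR_ge1Dxn n x0; have h : 0 < n.+1`!%:R :> R by rewrite ltr0n fact_gt0.
move=> le; rewrite mulrC -ler_pdivrMr//; apply: le_trans le.
by rewrite lerDr.
Qed.

(** Trades an exponential of |x|, in which the error terms are naturally bounded, for a cosh-type
    sum whose normal integral is explicit. *)
Lemma expR_norm_le (R : realType) (x : R) : expR `|x| <= expR x + expR (- x).
Proof.
by case: (ger0P x) => _; rewrite ?lerDl ?lerDr ?expR_ge0.
Qed.

Lemma measurable_scaled_cosh (R : realType) (c r : R) :
  measurable_fun setT (fun x : R => expR (c * (x / r)) + expR (- (c * (x / r)))).
Proof.
have mc : measurable_fun setT (fun x : R => c * (x / r)).
  by apply: measurable_funM => //; exact: measurable_funM.
by apply: measurable_funD; apply: measurableT_comp => //; exact: measurableT_comp.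
Qed.

Section normal.
Context (R : realType) (r : R).
Context (r0 : 0 < r).
Local Notation mu := (@lebesgue_measure R).
Local Notation N := (normal_prob 0 r).

Lemma ge0_integral_normal (f : R -> R) :
  measurable_fun setT f -> (forall x, 0 <= f x) ->
  (\int[N]_x (f x)%:E = \int[mu]_x (normal_pdf 0 r x * f x)%:E)%E.
Proof.
move=> mf f0; apply/esym.
apply: (@integral_weighted_pushforward _ _ _ _ _ mu N _ id f) => //.
- exact: measurable_normal_pdf.
- by move=> x; exact: normal_pdf_ge0.
move=> B mB; rewrite [RHS]integral_mkcond; apply: eq_integral => x _.
rewrite patchE indicE; case: ifP => _; by rewrite ?mulr1 ?mulr0.
Qed.

(* Multiplying the density by e^(t x / r) shifts its mean to t r. *)
Lemma normal_mgf (t : R) : (\int[N]_x (expR (t * (x / r)))%:E = (expR (t ^+ 2 / 2))%:E)%E.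
Proof.
rewrite ge0_integral_normal//; last first.
  by apply: measurableT_comp => //; apply: measurable_funM => //; apply: measurable_funM.
rewrite -[RHS]mule1 -(integral_normal_pdf (t * r) r) -ge0_integralZl//; first last.
- by move=> x _; rewrite lee_fin normal_pdf_ge0.
- by apply/measurable_EFinP; exact: measurable_normal_pdf.
apply: eq_integral => x _; rewrite -EFinM; congr EFin.
have rn0 : r != 0 by rewrite gt_eqF.
rewrite !normal_pdfE// [RHS]mulrCA -mulrA /normal_fun -!expRD; congr (_ * expR _).
by field.
Qed.

(** The centred density is even and Lebesgue measure is invariant under reflection. *)
Lemma ge0_integral_normalN (f : R -> R) :
  measurable_fun setT f -> (forall x, 0 <= f x) ->
  (\int[N]_x (f (- x))%:E = \int[N]_x (f x)%:E)%E.
Proof.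
move=> mf f0; have mfN : measurable_fun setT (fun x : R => f (- x)).
  exact: measurableT_comp.
rewrite !ge0_integral_normal//.
pose h x := normal_pdf 0 r x * f x.
have mh : measurable_fun setT h.
  by apply: measurable_funM => //; exact: measurable_normal_pdf.
have h0 x : 0 <= h x by rewrite mulr_ge0 ?normal_pdf_ge0.
rewrite -(@integral_weighted_pushforward _ _ _ _ _ mu mu (cst 1) -%R h)//.
  apply: eq_integral => x _; rewrite mul1r /h; congr ((_ * _)%:E).
  by rewrite !normal_pdfE ?gt_eqF// /normal_fun !subr0 sqrrN.
move=> B mB; under eq_integral do rewrite mul1r.
have mNB : measurable (-%R @^-1` B : set R).
  by rewrite -[_ @^-1` _]setTI; exact: oppr_measurable.
transitivity (mu (-%R @^-1` B)); last exact: lebesgue_measureN.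
by rewrite -[in RHS](setIT (-%R @^-1` B)) -integral_indic//; exact: eq_integral.
Qed.

Lemma normal_cosh (t : R) :
  (\int[N]_x (expR (t * (x / r)) + expR (- (t * (x / r))))%:E
   = (2 * expR (t ^+ 2 / 2))%:E)%E.
Proof.
have mexp c : measurable_fun setT (fun x : R => expR (c * (x / r))).
  by apply: measurableT_comp => //; apply: measurable_funM => //; apply: measurable_funM.
under eq_integral do rewrite EFinD -mulNr.
rewrite ge0_integralD//; first last.
- by apply/measurable_EFinP; exact: (mexp (- t)).
- by apply/measurable_EFinP; exact: (mexp t).
by rewrite !normal_mgf sqrrN -EFinD; congr EFin; ring.
Qed.

(* Both sides of [e^(tz) + e^(-tz) = 2 + (tz)^2 + O(t^4)] are integrated, and
   the fourth-order remainder is killed by dividing by t^2 and letting t tend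
   to 0. *)
Lemma integral_normal_sqr : (\int[N]_x ((x / r) ^+ 2)%:E = 1)%E.
Proof.
pose m := (\int[N]_x ((x / r) ^+ 2)%:E)%E.
have mz : measurable_fun setT (fun x : R => (x / r) ^+ 2).
  by apply: measurable_funX; exact: measurable_funM.
have mexp c := measurable_scaled_cosh c r.
have m0 : (0 <= m)%E by apply: integral_ge0 => x _; rewrite lee_fin sqr_ge0.
pose w (c x : R) := expR (c * (x / r)) + expR (- (c * (x / r))).
have w0 c x : 0 <= w c x by rewrite addr_ge0 ?expR_ge0.
(* Odd orders cancel between [y] and [-y]. Each of the two remainders is at most t^4 |z|^4 e^|z|;
   with |z|^4 <= 24 e^|z| and e^(2|z|) <= [w 2 x], the constant is 2 * 24 = 48. *)
have pointwise t x : 0 < t <= 1 ->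
    `|w t x - (2 + t ^+ 2 * (x / r) ^+ 2)| <= 48 * t ^+ 4 * w 2 x.
  move=> /andP[t0 t1]; rewrite /w; move: (x / r) => z; set y := t * z.
  have ty : `|y| <= `|z| by rewrite normrM gtr0_norm// ler_piMl.
  have -> : expR y + expR (- y) - (2 + t ^+ 2 * z ^+ 2) =
     (expR y - \sum_(k < 4) y ^+ k / k`!%:R) +
     (expR (- y) - \sum_(k < 4) (- y) ^+ k / k`!%:R).
    by rewrite !big_ord_recr/= !big_ord0/= !factS fact0 /y; field.
  apply: (le_trans (ler_normD _ _)).
  have := expR_taylor_bound (- y) 4; have := expR_taylor_bound y 4.
  rewrite normrN => b1 b2; apply: (le_trans (lerD b1 b2)).
  have e1 : expR `|y| <= expR `|z| by rewrite ler_expR.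
  have e2 : `|z| ^+ 4 <= 24 * expR `|z| by have := @exprn_le_expR R `|z| 4 (normr_ge0 _).
  have e3 : expR `|z| * expR `|z| <= expR (2 * z) + expR (- (2 * z)).
    rewrite -expRD (_ : `|z| + `|z| = `|2 * z|); last first.
      by rewrite normrM normr_nat; ring.
    exact: expR_norm_le.
  apply: (@le_trans _ _ (2 * (t ^+ 4 * (24 * expR `|z|) * expR `|z|))).
    rewrite -mulr2n -[leLHS]mulr_natl ler_pM2l//.
    apply: ler_pM; rewrite ?exprn_ge0 ?expR_ge0//.
    by rewrite {1}/y normrM exprMn gtr0_norm// ler_pM2l ?exprn_gt0.
  rewrite (_ : 2 * _ = 48 * t ^+ 4 * (expR `|z| * expR `|z|)); last by ring.
  by rewrite ler_pM2l// mulr_gt0 ?exprn_gt0.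
have intw c : (\int[N]_x (w c x)%:E = (2 * expR (c ^+ 2 / 2))%:E)%E by exact: normal_cosh.
have intq t : (\int[N]_x (2 + t ^+ 2 * (x / r) ^+ 2)%:E = 2%:E + (t ^+ 2)%:E * m)%E.
  under eq_integral do rewrite EFinD EFinM.
  rewrite ge0_integralD//; first last.
  - by apply/measurable_EFinP; apply: measurable_funM.
  - by move=> x _; rewrite lee_fin mulr_ge0// sqr_ge0.
  rewrite integral_cst// ge0_integralZl//; first last.
  - by rewrite lee_fin sqr_ge0.
  - by move=> x _; rewrite lee_fin sqr_ge0.
  - by apply/measurable_EFinP.
  by rewrite [X in (2%:E * X)%E]probability_setT mule1.
have intr K : 0 <= K -> (\int[N]_x (K * w 2 x)%:E = (K * (2 * expR 2))%:E)%E.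
  move=> K0; under eq_integral do rewrite EFinM.
  rewrite ge0_integralZl ?lee_fin//; first last.
  - by move=> x _; rewrite lee_fin.
  - by apply/measurable_EFinP; exact: mexp.
  by rewrite intw -EFinM; congr ((_ * (_ * expR _))%:E); field.
(* Both bounds are written without subtraction, because [m] is not yet known to be finite. The
   constant is 48 times the integral [2 * expR 2] of [w 2]. *)
have upper t : 0 < t <= 1 ->
    (2%:E + (t ^+ 2)%:E * m <= (2 * expR (t ^+ 2 / 2) + 96 * expR 2 * t ^+ 4)%:E)%E.
  move=> t01; rewrite -intq; have /andP[t0 _] := t01.
  have K0 : 0 <= 48 * t ^+ 4 by rewrite mulr_ge0// exprn_ge0// ltW.
  have -> : (2 * expR (t ^+ 2 / 2) + 96 * expR 2 * t ^+ 4)%:E =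
      (\int[N]_x (w t x)%:E + \int[N]_x (48 * t ^+ 4 * w 2 x)%:E)%E.
    by rewrite intw intr// -EFinD; congr EFin; ring.
  rewrite -ge0_integralD//; first last.
  - by apply/measurable_EFinP; apply: measurable_funM => //; exact: mexp.
  - by move=> x _; rewrite lee_fin mulr_ge0.
  - by apply/measurable_EFinP; exact: mexp.
  - by move=> x _; rewrite lee_fin.
  apply: ge0_le_integral => //.
  - by move=> x _; rewrite lee_fin addr_ge0// mulr_ge0// sqr_ge0.
  - by apply/measurable_EFinP; apply: measurable_funD => //; apply: measurable_funM.
  - apply/measurable_EFinP; apply: measurable_funD; first exact: mexp.
    by apply: measurable_funM => //; exact: mexp.
  - move=> x _; rewrite -EFinD lee_fin.
    by have := pointwise t x t01; rewrite ler_norml => /andP[+ _]; lra.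
have lower t : 0 < t <= 1 ->
    ((2 * expR (t ^+ 2 / 2))%:E <= 2%:E + (t ^+ 2)%:E * m + (96 * expR 2 * t ^+ 4)%:E)%E.
  move=> t01; rewrite -intq -intw; have /andP[t0 _] := t01.
  have K0 : 0 <= 48 * t ^+ 4 by rewrite mulr_ge0// exprn_ge0// ltW.
  have -> : (96 * expR 2 * t ^+ 4)%:E = (\int[N]_x (48 * t ^+ 4 * w 2 x)%:E)%E.
    by rewrite intr//; congr EFin; ring.
  rewrite -ge0_integralD//; first last.
  - by apply/measurable_EFinP; apply: measurable_funM => //; exact: mexp.
  - by move=> x _; rewrite lee_fin mulr_ge0.
  - by apply/measurable_EFinP; apply: measurable_funD => //; apply: measurable_funM.
  - by move=> x _; rewrite lee_fin addr_ge0// mulr_ge0// sqr_ge0.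
  apply: ge0_le_integral => //.
  - by move=> x _; rewrite lee_fin.
  - by apply/measurable_EFinP; exact: mexp.
  - apply/measurable_EFinP; apply: measurable_funD.
      by apply: measurable_funD => //; apply: measurable_funM.
    by apply: measurable_funM => //; exact: mexp.
  - move=> x _; rewrite -EFinD lee_fin.
    by have := pointwise t x t01; rewrite ler_norml => /andP[_ +]; lra.
(* The upper bound at [t = 1] already excludes [m = +oo]. *)
have mfin : m \is a fin_num.
  rewrite ge0_fin_numE//; have := upper 1; rewrite ltr01 lexx => /(_ isT).
  rewrite expr1n mul1e; case: (m) m0 => [s| |]//=.
  by rewrite ltry.
rewrite -/m -(fineK mfin); congr EFin; set v := fine m.
(* The two bounds now hold between reals, and e^(t^2/2) is expanded as 1 + t^2/2 + O(t^4). *)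
have close t : 0 < t <= 1 -> t ^+ 2 * `|v - 1| <= (96 * expR 2 + 2 * expR 1) * t ^+ 4.
  move=> t01; have := upper t t01; have := lower t t01.
  rewrite -(fineK mfin) -/v -EFinM -!EFinD !lee_fin => lo up.
  have /andP[t0 t1] := t01.
  have t21 : t ^+ 2 <= 1 by rewrite exprn_ile1// ltW.
  have u0 : 0 <= t ^+ 2 / 2 by rewrite divr_ge0// sqr_ge0.
  have e1 : expR (t ^+ 2 / 2) <= expR 1 by rewrite ler_expR; lra.
  have := expR_taylor_bound (t ^+ 2 / 2) 2.
  rewrite !big_ord_recr/= big_ord0/= (ger0_norm u0) !fact0 factS fact0.
  rewrite expr0 expr1 add0r !divr1.
  have -> : (t ^+ 2 / 2) ^+ 2 = t ^+ 4 / 4 by field.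
  have t40 : 0 <= t ^+ 4 by rewrite exprn_ge0 ?ltW.
  have := ler_wpM2l t40 e1.
  rewrite -[t ^+ 2 in X in _ -> _ -> X]gtr0_norm ?exprn_gt0// -normrM.
  set a := t ^+ 4 * expR (t ^+ 2 / 2); set b := t ^+ 4 * expR 1 => ab.
  have -> : t ^+ 4 / 4 * expR (t ^+ 2 / 2) = a / 4 by rewrite /a; field.
  have b0 : 0 <= b by rewrite mulr_ge0 ?expR_ge0.
  rewrite !ler_norml => /andP[l1 l2].
  have -> : (96 * expR 2 + 2 * expR 1) * t ^+ 4 = 96 * expR 2 * t ^+ 4 + 2 * b.
    by rewrite /b; ring.
  by apply/andP; split; lra.
apply/eqP; rewrite -subr_eq0 -normr_le0 leNgt; apply/negP => d0.
set K := 96 * expR 2 + 2 * expR 1 in close.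
have K0 : 0 < K by rewrite addr_gt0// mulr_gt0 ?expR_gt0.
(* With d = |v - 1| this [t] solves (d + K) t = d, so that K t^2 <= K t < (d + K) t = d, against the
   bound d <= K t^2 left after division by t^2. *)
pose t := `|v - 1| / (`|v - 1| + K).
have tp : 0 < t by rewrite divr_gt0// addr_gt0.
have t1 : t < 1 by rewrite ltr_pdivrMr ?addr_gt0// mul1r ltrDl.
have := close t; rewrite tp ltW// => /(_ isT).
rewrite (_ : K * t ^+ 4 = t ^+ 2 * (K * t ^+ 2)); last by ring.
rewrite ler_pM2l ?exprn_gt0// leNgt => /negP; apply.
apply: (@lt_le_trans _ _ ((`|v - 1| + K) * t)); last first.
  by rewrite mulrC divfK// gt_eqF// addr_gt0.
rewrite expr2 mulrA ltr_pM2r//.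
apply: (@le_lt_trans _ _ K); first by rewrite ler_piMr// ltW.
by rewrite ltrDr.
Qed.
End normal.

(** * One step of the scheme *)

(** The bracket of the recursion for [milstein_rho], with [a] standing for the almost sure rate
    [lam + eps^2/2 - sig^2/2], [s] for [sig], [h] for the step and [x] for the Brownian
    increment. *)
Definition milstein_factor (R : realType) (a s h x : R) : R :=
  1 + a * h + s * x + s ^+ 2 / 2 * x ^+ 2.

(** Completing the square turns the noise into (1 + s x)^2 / 2, so the bound is deterministic: it
    holds for every increment [x], and logarithms and negative powers of the factor are controlled
    on every path. *)
Lemma milstein_factor_ge (R : realType) (a s h x : R) :
  0 <= h -> 4 * (`|a| + 1) * h <= 1 -> 1 / 4 <= milstein_factor a s h x.
Proof.
move=> h0 h1.
have -> : milstein_factor a s h x = 1 / 2 + a * h + (1 + s * x) ^+ 2 / 2.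
  by rewrite /milstein_factor; field.
have := sqr_ge0 (1 + s * x); have := ler_wpM2r h0 (ler_norm (- a)).
by rewrite normrN mulNr; move: (a * h) h1 => ah; rewrite mulrDr mulrDl; lra.
Qed.

(** From e^y <= 1 + y e^y the remainder is at most y (e^y - 1), which is at most y^2 e^y for y >= 0
    and at most y^2 for y < 0. The factor [1 + expR y] covers both signs. *)
Lemma expR_le_quadratic (R : realType) (y : R) :
  expR y <= 1 + y + y ^+ 2 * (1 + expR y).
Proof.
have e0 := expR_gt0 y; have e1 := expR_ge1Dx y.
have e2 : expR y * (1 - y) <= 1.
  by rewrite -[leRHS](expRxMexpNx_1 y) ler_pM2l// expR_ge1Dx.
case: (lerP 0 y) => y0.
  by nra.
by nra.
Qed.

(** The inequality ln u <= u - 1 is applied to [x] and to its inverse. *)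
Lemma ln_sandwich (R : realType) (x : R) : 0 < x -> 1 - x^-1 <= ln x <= x - 1.
Proof.
move=> x0; apply/andP; split; last first.
  by have := @le_ln1Dx R (x - 1); rewrite addrCA subrr addr0; apply; lra.
have xi : 0 < x^-1 by rewrite invr_gt0.
have := @le_ln1Dx R (x^-1 - 1); rewrite addrCA subrr addr0 lnV ?posrE//.
have : -1 < x^-1 - 1 by lra.
by move=> h /(_ h); lra.
Qed.

Section one_step.
Context (R : realType) (a s : R).
Local Notation A := `|a|.
Local Notation S := `|s|.
Local Notation F := (milstein_factor a s).
Local Notation K1 := (A + S + S ^+ 2).
(** A single majorant for all error terms: for the increment [x = r z] with [r <= 1], it dominates
    1, |z| and e^|s r z|, so every error becomes a power of [r] times a power of [E z], which is
    integrable under the normal law. *)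
Local Notation E z := (expR ((S + 1) * `|z|)).

Let E_ge1 (z : R) : 1 <= E z.
Proof. by rewrite -[leLHS]expR0 ler_expR mulr_ge0// addr_ge0. Qed.

Let norm_leE (z : R) : `|z| <= E z.
Proof.
have := expR_ge1Dx ((S + 1) * `|z|); have : 0 <= S * `|z| by rewrite mulr_ge0.
by rewrite mulrDl mul1r; lra.
Qed.

Let exp_leE (r z : R) : 0 < r <= 1 -> expR `|s * (r * z)| <= E z.
Proof.
move=> /andP[r0 r1]; rewrite ler_expR !normrM (gtr0_norm r0).
have : 0 <= (1 - r) * (S * `|z|) by rewrite mulr_ge0 ?mulr_ge0//; lra.
have : 0 <= `|z| by [].
by move=> h1 h2; rewrite mulrDl mul1r mulrCA; lra.
Qed.

Let norm_le_rE (r z : R) : 0 < r -> `|s * (r * z)| <= S * r * E z.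
Proof.
move=> r0; rewrite !normrM (gtr0_norm r0) mulrA ler_wpM2l//.
by rewrite mulr_ge0// ltW.
Qed.

(** With y = s r z the increment is a r^2 + y + y^2/2. The three summands of [K1] are the
    coefficients of these terms, the excess powers of [r <= 1] being dropped and those of [E z >= 1]
    raised to 2. *)
Lemma milstein_factor_increment (r z : R) : 0 < r <= 1 ->
  `|F (r ^+ 2) (r * z) - 1| <= K1 * r * E z ^+ 2.
Proof.
move=> /andP[r0 r1]; have yE := norm_le_rE z r0.
have E1 := E_ge1 z; set e := E z in yE E1 *.
have -> : F (r ^+ 2) (r * z) - 1 = a * r ^+ 2 + s * (r * z) + (s * (r * z)) ^+ 2 / 2.
  by rewrite /milstein_factor; field.
set y := s * (r * z) in yE *.
apply: (le_trans (ler_normD _ _)); apply: (le_trans (lerD (ler_normD _ _) (lexx _))).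
have e0 : 0 <= e by lra.
have e2 : e <= e ^+ 2 by rewrite expr2 ler_peMr.
have h1 : `|a * r ^+ 2| <= A * r * e ^+ 2.
  rewrite normrM normrX (gtr0_norm r0) -mulrA ler_wpM2l// [r ^+ 2]expr2 ler_wpM2l ?(ltW r0)//.
  by apply: (le_trans r1); rewrite exprn_ege1.
have h2 : `|y| <= S * r * e ^+ 2.
  by apply: (le_trans yE); rewrite ler_wpM2l// mulr_ge0// ltW.
have h3 : `|y ^+ 2 / 2| <= S ^+ 2 * r * e ^+ 2.
  rewrite normrM normrX normfV normr_nat.
  apply: (@le_trans _ _ (`|y| ^+ 2)); first by have := exprn_ge0 2 (normr_ge0 y); lra.
  apply: (@le_trans _ _ ((S * r * e) ^+ 2)); first by rewrite ler_sqr ?nnegrE ?(le_trans _ yE).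
  rewrite !exprMn ler_wpM2r ?exprn_ge0// ler_wpM2l ?exprn_ge0//.
  by rewrite expr2 ler_piMr// ltW.
by rewrite !mulrDl; lra.
Qed.

(* With y = s r z, the ratio [F / e^y] is [1 + a r^2] up to [O(r^3)], and
   [ln F - y] lies between [1 - e^y / F] and [F / e^y - 1]. *)
Lemma ln_milstein_factor (r z : R) : 0 < r <= 1 -> 4 * (A + 1) * r ^+ 2 <= 1 ->
  `|ln (F (r ^+ 2) (r * z)) - (a * r ^+ 2 + s * (r * z))|
    <= 4 * (S ^+ 3 + A * K1 + A * S) * r ^+ 3 * E z ^+ 5.
Proof.
move=> r01 hr; have hu := milstein_factor_increment z r01.
have F4 : 1 / 4 <= F (r ^+ 2) (r * z) by apply: milstein_factor_ge; rewrite ?sqr_ge0.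
have eE := exp_leE z r01; have /andP[r0 r1] := r01.
have yE := norm_le_rE z r0; have E1 := E_ge1 z.
have k10 : 0 <= K1 by rewrite !addr_ge0 ?sqr_ge0.
(* The quadratic Milstein correction makes F - a r^2 exactly the second-order Taylor polynomial of
   e^y, hence an error of third order in [r]. *)
have Fq : F (r ^+ 2) (r * z) = a * r ^+ 2 + (1 + s * (r * z) + (s * (r * z)) ^+ 2 / 2).
  by rewrite /milstein_factor; field.
move: Fq F4 hu eE yE E1 k10.
set e := E z; set f := F _ _; set y := s * (r * z); set q := 1 + y + _.
set k1 := A + S + _ => Fq F4 hu eE yE E1 k10.
have e0 : 0 < e by lra.
have f0 : 0 < f by lra.
have T3 : `|expR y - q| <= S ^+ 3 * r ^+ 3 * e ^+ 4.
  have := expR_taylor_bound y 3.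
  rewrite !big_ord_recr/= big_ord0/= !factS !fact0 => T.
  rewrite (_ : q = 0 + y ^+ 0 / 1%N%:R + y ^+ 1 / (1 * 1)%N%:R +
      y ^+ 2 / (2 * (1 * 1))%N%:R); last first.
    by rewrite /q; field.
  apply: (le_trans T).
  rewrite (_ : S ^+ 3 * r ^+ 3 * e ^+ 4 = (S * r * e) ^+ 3 * e); last by ring.
  apply: ler_pM => //; rewrite ?exprn_ge0 ?expR_ge0//.
  by rewrite lerXn2r ?nnegrE// (le_trans _ yE).
have T1 : `|expR (- y) - 1| <= S * r * e ^+ 2.
  have := expR_taylor_bound (- y) 1.
  rewrite big_ord1 fact0 expr0 divr1 expr1 normrN => /le_trans; apply.
  rewrite expr2 mulrA; apply: ler_pM => //; exact: expR_ge0.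
have emy : expR (- y) <= e by apply: le_trans eE; rewrite ler_expR -normrN ler_norm.
have lnf c : 0 < c -> ln (f * c) = ln f + ln c by move=> c0; rewrite lnM ?posrE.
have /andP[lo up] : 1 - (f * expR (- y))^-1 <= ln (f * expR (- y)) <= f * expR (- y) - 1.
  by apply: ln_sandwich; rewrite mulr_gt0// expR_gt0.
rewrite lnf ?expR_gt0// expRK in up lo.
have Ar : `|a * r ^+ 2| = A * r ^+ 2 by rewrite normrM normrX (gtr0_norm r0).
have fi : f^-1 <= 4 by rewrite -[leRHS]invrK lef_pV2 ?posrE ?invr_gt0//; lra.
have fi0 : 0 < f^-1 by rewrite invr_gt0.
have upper : f * expR (- y) - 1 - a * r ^+ 2 <=
    S ^+ 3 * r ^+ 3 * e ^+ 5 + A * S * r ^+ 3 * e ^+ 2.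
  have -> : f * expR (- y) - 1 - a * r ^+ 2 =
     (q - expR y) * expR (- y) + a * r ^+ 2 * (expR (- y) - 1).
    by rewrite Fq; have := expRxMexpNx_1 y => ey; ring: ey.
  apply: lerD; apply: (le_trans (ler_norm _)); rewrite normrM.
    rewrite distrC (_ : _ * e ^+ 5 = S ^+ 3 * r ^+ 3 * e ^+ 4 * e); last by ring.
    by apply: ler_pM => //; rewrite ger0_norm ?expR_ge0.
  rewrite Ar (_ : _ * e ^+ 2 = A * r ^+ 2 * (S * r * e ^+ 2)); last by ring.
  by apply: ler_wpM2l; rewrite // mulr_ge0// exprn_ge0// ltW.
have lower : (f * expR (- y))^-1 - 1 + a * r ^+ 2 <=
    4 * (S ^+ 3 * r ^+ 3 * e ^+ 4 + A * r ^+ 2 * (k1 * r * e ^+ 2)).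
  have -> : (f * expR (- y))^-1 - 1 + a * r ^+ 2 =
     f^-1 * ((expR y - q) + a * r ^+ 2 * (f - 1)).
    rewrite invfM -expRN opprK.
    have ff : f^-1 * f = 1 by rewrite mulVf// gt_eqF.
    have -> : q = f - a * r ^+ 2 by rewrite Fq; ring.
    by ring: ff.
  apply: (@le_trans _ _ (f^-1 * (S ^+ 3 * r ^+ 3 * e ^+ 4 + A * r ^+ 2 * (k1 * r * e ^+ 2)))).
    rewrite ler_pM2l//; apply: lerD; apply: (le_trans (ler_norm _)) => //.
    by rewrite normrM Ar ler_wpM2l// mulr_ge0// exprn_ge0// ltW.
  rewrite ler_wpM2r// !addr_ge0 ?mulr_ge0 ?exprn_ge0 ?(ltW r0) ?(ltW e0)//.
have pw k : (k <= 5)%N -> e ^+ k <= e ^+ 5 by move=> ?; rewrite ler_weXn2l.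
have r30 : 0 <= r ^+ 3 by rewrite exprn_ge0// ltW.
have b1 : S ^+ 3 * r ^+ 3 * e ^+ 4 <= S ^+ 3 * r ^+ 3 * e ^+ 5.
  by rewrite ler_wpM2l ?pw// mulr_ge0// exprn_ge0.
have b2 : A * S * r ^+ 3 * e ^+ 2 <= A * S * r ^+ 3 * e ^+ 5.
  by rewrite ler_wpM2l ?pw// mulr_ge0// mulr_ge0.
have b3 : A * r ^+ 2 * (k1 * r * e ^+ 2) <= A * k1 * r ^+ 3 * e ^+ 5.
  rewrite (_ : A * r ^+ 2 * _ = A * k1 * r ^+ 3 * e ^+ 2); last by ring.
  by rewrite ler_wpM2l ?pw// mulr_ge0// mulr_ge0.
have p1 : 0 <= S ^+ 3 * r ^+ 3 * e ^+ 5 by rewrite !mulr_ge0 ?exprn_ge0 ?(ltW e0) ?(ltW r0).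
have p2 : 0 <= A * S * r ^+ 3 * e ^+ 5 by rewrite !mulr_ge0 ?exprn_ge0 ?(ltW e0) ?(ltW r0).
have p3 : 0 <= A * k1 * r ^+ 3 * e ^+ 5 by rewrite !mulr_ge0 ?exprn_ge0 ?(ltW e0) ?(ltW r0).
rewrite (_ : 4 * _ * r ^+ 3 * e ^+ 5 = 4 * (S ^+ 3 * r ^+ 3 * e ^+ 5) +
  4 * (A * k1 * r ^+ 3 * e ^+ 5) + 4 * (A * S * r ^+ 3 * e ^+ 5)); last by ring.
by rewrite ler_norml; apply/andP; split; lra.
Qed.

(** [expR_le_quadratic] is applied to p ln F. As |p| <= r, the third-order error of ln F becomes of
    order r^4, and so does (p ln F)^2. The term p s r z, linear in z, is kept exact because symmetry
    will cancel it. *)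
Lemma expR_ln_milstein_factor_le (r p z : R) : 0 < r <= 1 -> 4 * (A + 1) * r ^+ 2 <= 1 ->
  `|p| <= r ->
  expR (p * ln (F (r ^+ 2) (r * z))) <=
    1 + p * (a * r ^+ 2 + s * (r * z)) +
    (4 * (S ^+ 3 + A * K1 + A * S) + 16 * K1 ^+ 2 * (6 + K1)) * r ^+ 4 * E z ^+ 6.
Proof.
move=> /andP[r0 r1] hr pr.
have r01 : 0 < r <= 1 by apply/andP.
have F4 : 1 / 4 <= F (r ^+ 2) (r * z) by apply: milstein_factor_ge; rewrite ?sqr_ge0.
have := milstein_factor_increment z r01.
have := ln_milstein_factor z r01 hr.
have E1 : 1 <= E z by rewrite -[leLHS]expR0 ler_expR mulr_ge0// addr_ge0.
move: E1 F4; set e := E z; set f := F _ _; set k := 4 * _; set k1 := A + S + _.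
set l := a * _ + _ => E1 F4 hL hu.
have f0 : 0 < f by lra.
have k10 : 0 <= k1 by rewrite !addr_ge0 ?sqr_ge0.
have k0 : 0 <= k by rewrite mulr_ge0// !addr_ge0 ?mulr_ge0 ?exprn_ge0 ?addr_ge0 ?sqr_ge0.
have /andP[Lo Up] := ln_sandwich f0.
have fi : f^-1 <= 4 by rewrite -[leRHS]invrK lef_pV2 ?posrE ?invr_gt0//; lra.
(* Since 1/f <= 4, the sandwich of the logarithm gives |ln f| <= 4 |f - 1|. *)
have L4 : ln f ^+ 2 <= 16 * (f - 1) ^+ 2.
  have Lo' : (f - 1) * f^-1 <= ln f by rewrite mulrBl divff ?gt_eqF// mul1r.
  rewrite -(real_normK (num_real (ln f))) -(real_normK (num_real (f - 1))).
  rewrite (_ : 16 * _ = (4 * `|f - 1|) ^+ 2); last by ring.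
  rewrite ler_sqr ?nnegrE ?mulr_ge0//.
  have fi0 : 0 < f^-1 by rewrite invr_gt0.
  case: (lerP 1 f) => f1.
    by rewrite !ger0_norm; nra.
  by rewrite !ltr0_norm; nra.
(* As |p| <= 1, the left side is at most e^|ln f| <= f + 1/f. *)
have eL : expR (p * ln f) <= f + 4.
  have pL : p * ln f <= `|ln f|.
    rewrite (le_trans (ler_norm _))// normrM ler_piMl//; lra.
  apply: (@le_trans _ _ (expR `|ln f|)); first by rewrite ler_expR.
  apply: (le_trans (expR_norm_le _)).
  by rewrite expRN lnK ?posrE//; lra.
have p2 : p ^+ 2 <= r ^+ 2 by rewrite -real_normK ?num_real// ler_sqr ?nnegrE ?(ltW r0).
have u2 : (f - 1) ^+ 2 <= k1 ^+ 2 * r ^+ 2 * e ^+ 4.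
  rewrite -real_normK ?num_real// (_ : k1 ^+ 2 * r ^+ 2 * e ^+ 4 = (k1 * r * e ^+ 2) ^+ 2); last by ring.
  by rewrite ler_sqr ?nnegrE// !mulr_ge0 ?exprn_ge0//; lra.
have f5 : 5 + f <= (6 + k1) * e ^+ 2.
  have : 1 <= e ^+ 2 by rewrite exprn_ege1.
  have : k1 * r * e ^+ 2 <= k1 * e ^+ 2.
    by rewrite ler_wpM2r ?exprn_ge0// ?ler_piMr//; lra.
  move: hu; rewrite ler_norml => /andP[_ hu] h1 h2; lra.
apply: (le_trans (expR_le_quadratic _)).
have quad : (p * ln f) ^+ 2 * (1 + expR (p * ln f)) <=
    16 * k1 ^+ 2 * (6 + k1) * r ^+ 4 * e ^+ 6.
  rewrite (_ : 16 * k1 ^+ 2 * (6 + k1) * r ^+ 4 * e ^+ 6 =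
    (r ^+ 2 * (16 * (k1 ^+ 2 * r ^+ 2 * e ^+ 4))) * ((6 + k1) * e ^+ 2)); last by ring.
  rewrite exprMn; apply: ler_pM.
  - by rewrite mulr_ge0// sqr_ge0.
  - by rewrite addr_ge0// expR_ge0.
  - apply: ler_pM; rewrite ?sqr_ge0//; apply: (le_trans L4).
    by rewrite ler_pM2l.
  - by apply: le_trans f5; lra.
have lin : p * ln f <= p * l + k * r ^+ 4 * e ^+ 6.
  rewrite -lerBlDl -mulrBr (le_trans (ler_norm _))// normrM.
  apply: (@le_trans _ _ (r * (k * r ^+ 3 * e ^+ 5))); first exact: ler_pM.
  rewrite (_ : k * r ^+ 4 * e ^+ 6 = r * (k * r ^+ 3 * e ^+ 5) * e); last by ring.
  by rewrite ler_peMr// !mulr_ge0 ?exprn_ge0//; lra.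
rewrite !mulrDl; lra.
Qed.
End one_step.

(** * Moments of the one-step factor under the normal law *)

(** Functions of this form are the explicit majorants and minorants used for both moment estimates.
    The signs of the coefficients keep every integral nonnegative. *)
Lemma integral_normal_quadratic_cosh (R : realType) (r c K0 K1 K2 : R) :
  0 < r -> 0 <= K0 -> 0 <= K1 -> 0 <= K2 ->
  (\int[normal_prob 0 r]_x (K0 + K1 * (x / r) ^+ 2 +
      K2 * (expR (c * (x / r)) + expR (- (c * (x / r)))))%:E
   = (K0 + K1 + K2 * (2 * expR (c ^+ 2 / 2)))%:E)%E.
Proof.
move=> r0 K00 K10 K20.
have mz : measurable_fun setT (fun x : R => (x / r) ^+ 2).
  by apply: measurable_funX; exact: measurable_funM.
have mcosh := measurable_scaled_cosh c r.
have c0 x : 0 <= expR (c * (x / r)) + expR (- (c * (x / r))).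
  by rewrite addr_ge0 ?expR_ge0.
under eq_integral do rewrite !EFinD EFinM (EFinM K2).
rewrite ge0_integralD//=; first last.
- by apply: measurable_funeM; exact/measurable_EFinP.
- by move=> x _; rewrite mule_ge0 ?lee_fin.
- apply: emeasurable_funD => //; apply: measurable_funeM; exact/measurable_EFinP.
- by move=> x _; rewrite adde_ge0 ?mule_ge0 ?lee_fin// sqr_ge0.
rewrite ge0_integralD//=; first last.
- apply: measurable_funeM; exact/measurable_EFinP.
- by move=> x _; rewrite mule_ge0 ?lee_fin// sqr_ge0.
rewrite !ge0_integralZl ?lee_fin//; first last.
- by move=> x _; rewrite lee_fin sqr_ge0.
- exact/measurable_EFinP.
- exact/measurable_EFinP.
rewrite integral_normal_sqr// normal_cosh// integral_cst//= mule1.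
by rewrite [X in (_ * X)%E]probability_setT mule1.
Qed.

Lemma measurable_quadratic_cosh (R : realType) (r c K0 K1 K2 : R) :
  measurable_fun setT (fun x : R => K0 + K1 * (x / r) ^+ 2 +
      K2 * (expR (c * (x / r)) + expR (- (c * (x / r))))).
Proof.
apply: measurable_funD; last first.
  by apply: measurable_funM => //; exact: measurable_scaled_cosh.
apply: measurable_funD => //; apply: measurable_funM => //.
by apply: measurable_funX; exact: measurable_funM.
Qed.

(** Odd terms cancel pointwise in g(x) + g(-x), so they disappear before integration and only
    nonnegative functions are integrated. *)
Lemma integral_normal_symmetrize (R : realType) (r : R) (g : R -> R) :
  0 < r -> measurable_fun setT g -> (forall x, 0 <= g x) ->
  (\int[normal_prob 0 r]_x (g x + g (- x))%:E
   = 2%:E * \int[normal_prob 0 r]_x (g x)%:E)%E.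
Proof.
move=> r0 mg g0; under eq_integral do rewrite EFinD.
have mgN : measurable_fun setT (fun x : R => g (- x)) by exact: measurableT_comp.
rewrite ge0_integralD//=; first last.
- exact/measurable_EFinP.
- by move=> x _; rewrite lee_fin.
- exact/measurable_EFinP.
- by move=> x _; rewrite lee_fin.
by rewrite ge0_integral_normalN// -mule2n muleC mule_natr.
Qed.

Lemma measurable_milstein_factor (R : realType) (a s h : R) :
  measurable_fun setT (milstein_factor a s h).
Proof.
apply: measurable_funD; first by apply: measurable_funD => //; exact: measurable_funM.
by apply: measurable_funM => //; exact: measurable_funX.
Qed.

Lemma measurable_expR_ln_milstein_factor (R : realType) (a s h p : R) :
  measurable_fun setT (fun x => expR (p * ln (milstein_factor a s h x))).
Proof.
apply: measurableT_comp => //; apply: measurable_funM => //.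
apply: measurableT_comp; [exact: measurable_ln|exact: measurable_milstein_factor].
Qed.

(** Averaging the pointwise bound over [x] and [-x] cancels its odd term, and 1 + y <= e^y turns the
    result into an exponential. The constant [K] depends on neither [p] nor [r], so both p = r and p
    = -r are covered. *)
Lemma milstein_factor_moment (R : realType) (a s : R) :
  exists2 K : R, 0 <= K & forall r p : R, 0 < r <= 1 ->
    4 * (`|a| + 1) * r ^+ 2 <= 1 -> `|p| <= r ->
  exists2 m : R, 0 <= m <= expR (p * a * r ^+ 2 + K * r ^+ 4) &
    (\int[normal_prob 0 r]_x (expR (p * ln (milstein_factor a s (r ^+ 2) x)))%:E = m%:E)%E.
Proof.
pose k := 4 * (`|s| ^+ 3 + `|a| * (`|a| + `|s| + `|s| ^+ 2) + `|a| * `|s|) +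
  16 * (`|a| + `|s| + `|s| ^+ 2) ^+ 2 * (6 + (`|a| + `|s| + `|s| ^+ 2)).
have k0 : 0 <= k.
  by rewrite !(addr_ge0, mulr_ge0, exprn_ge0).
pose c := 6 * (`|s| + 1).
exists (k * (2 * expR (c ^+ 2 / 2))); first by rewrite !mulr_ge0 ?expR_ge0.
move=> r p r01 hr pr; have /andP[r0 r1] := r01.
set g := fun x => expR (p * ln (milstein_factor a s (r ^+ 2) x)).
have mg : measurable_fun setT g by exact: measurable_expR_ln_milstein_factor.
have g0 x : 0 <= g x by exact: expR_ge0.
pose q := p * a * r ^+ 2.
(* Makes the constant coefficient 2 + 2 q of the majorant nonnegative. *)
have q0 : -1 <= q.
  have : `|q| <= 1.
    rewrite /q -mulrA normrM [X in _ * X]normrM (ger0_norm (sqr_ge0 r)).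
    have ar0 : 0 <= `|a| * r ^+ 2 by rewrite mulr_ge0// sqr_ge0.
    apply: (@le_trans _ _ (1 * (`|a| * r ^+ 2))).
      by rewrite ler_wpM2r// (le_trans pr).
    by have := sqr_ge0 r; move: hr; rewrite mulrDr mulrDl -mulrA; lra.
  by rewrite ler_norml => /andP[].
have rn0 : r != 0 by rewrite gt_eqF.
have gle x : g x + g (- x) <= (2 + 2 * q) + 0 * (x / r) ^+ 2 +
    2 * k * r ^+ 4 * (expR (c * (x / r)) + expR (- (c * (x / r)))).
  have key z : expR (6 * ((`|s| + 1) * `|z|)) <= expR (c * z) + expR (- (c * z)).
    apply: le_trans (expR_norm_le _); rewrite ler_expR normrM.
    by rewrite ger0_norm ?mulr_ge0 ?addr_ge0// /c mulrA.
  have gz z : g (r * z) <= 1 + q + p * (s * (r * z)) +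
      k * r ^+ 4 * (expR (c * z) + expR (- (c * z))).
    have := @expR_ln_milstein_factor_le _ a s r p z r01 hr pr.
    move=> /le_trans; apply.
    rewrite (_ : 1 + q + _ = 1 + p * (a * r ^+ 2 + s * (r * z))); last by rewrite /q; ring.
    rewrite lerD2l ler_wpM2l ?mulr_ge0 ?exprn_ge0 ?(ltW r0)//.
    by rewrite -expRM_natl.
  have := gz (x / r); have := gz (- (x / r)).
  rewrite !mulrN opprK [r * (x / r)]mulrC divfK//.
  set e1 := expR (c * _); set e2 := expR (- _).
  set k' := k * r ^+ 4; rewrite -(mulrA 2 k) -/k'; lra.
have : (2%:E * \int[normal_prob 0 r]_x (g x)%:E <=
    (2 * (1 + q + k * (2 * expR (c ^+ 2 / 2)) * r ^+ 4))%:E)%E.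
  rewrite -integral_normal_symmetrize//.
  have -> : 2 * (1 + q + k * (2 * expR (c ^+ 2 / 2)) * r ^+ 4) =
      2 + 2 * q + 0 + 2 * k * r ^+ 4 * (2 * expR (c ^+ 2 / 2)) by ring.
  rewrite -(@integral_normal_quadratic_cosh _ r)//; first last.
  - by have r4 := exprn_ge0 4 (ltW r0); rewrite mulr_ge0// mulr_ge0.
  - lra.
  apply: ge0_le_integral => //.
  - by move=> x _; rewrite lee_fin addr_ge0.
  - apply/measurable_EFinP; apply: measurable_funD => //; exact: measurableT_comp.
  - by apply/measurable_EFinP; exact: measurable_quadratic_cosh.
  - by move=> x _; rewrite lee_fin.
set I := (\int[_]_x _)%E => Ile.
have I0 : (0 <= I)%E by apply: integral_ge0 => x _; rewrite lee_fin.
have Ifin : I \is a fin_num.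
  rewrite ge0_fin_numE//; move: Ile; case: (I) I0 => [?| |]//=; first by rewrite ltry.
  by rewrite mulry gtr0_sg// mul1e.
exists (fine I); last by rewrite fineK.
rewrite fine_ge0//=.
move: Ile; rewrite -(fineK Ifin) -EFinM lee_fin ler_pM2l// => /le_trans; apply.
by rewrite -addrA; exact: expR_ge1Dx.
Qed.

(** The symmetrized square is an even quartic in z = x / r. Its constant and quadratic terms
    integrate to 2 (1 + 2 b h) up to O(h^2), and the quartic term carries h^2. A two-sided
    exponential form follows from m = 1 + 2 b h + O(h^2). *)
Lemma milstein_factor_moment2 (R : realType) (a s : R) :
  exists2 C : R, 0 < C & forall r : R, 0 < r <= 1 -> 4 * (`|a| + 1) * r ^+ 2 <= 1 ->
  exists2 m : R,
    expR (2 * (a + s ^+ 2 - C * r ^+ 2) * r ^+ 2) <= m <=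
    expR (2 * (a + s ^+ 2 + C * r ^+ 2) * r ^+ 2) &
    (\int[normal_prob 0 r]_x (milstein_factor a s (r ^+ 2) x ^+ 2)%:E = m%:E)%E.
Proof.
pose b := a + s ^+ 2.
pose k := `|a ^+ 2 + a * s ^+ 2| + 12 * expR (1 / 2) * s ^+ 4.
have s4 : 0 <= s ^+ 4 by rewrite exprn_even_ge0.
have k0 : 0 <= k by rewrite addr_ge0// mulr_ge0// mulr_ge0// expR_ge0.
have C0 : 0 <= (2 * `|b| + k) ^+ 2 by rewrite sqr_ge0.
(* [k] bounds the h^2 error of m, the square pays for the error 2 (m - 1)^2 made when passing from m
   to an exponential, and 1 ensures positivity. *)
exists (1 + k + (2 * `|b| + k) ^+ 2) => [|r r01 hr]; first lra.
have /andP[r0 r1] := r01; set h := r ^+ 2.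
have h0 : 0 < h by rewrite exprn_gt0.
have h1 : h <= 1 by rewrite exprn_ile1// ltW.
set g := fun x => milstein_factor a s h x ^+ 2.
have mg : measurable_fun setT g.
  by apply: measurable_funX; exact: measurable_milstein_factor.
have g0 x : 0 <= g x by exact: sqr_ge0.
pose I := (\int[normal_prob 0 r]_x (g x)%:E)%E.
pose K0 := 2 * (1 + a * h) ^+ 2; pose K1 := 2 * (2 + a * h) * s ^+ 2 * h.
pose K2 := 12 * s ^+ 4 * h ^+ 2.
have ah : - (1 / 4) <= a * h <= 1 / 4.
  have : `|a * h| <= 1 / 4.
    rewrite normrM (gtr0_norm h0); have := normr_ge0 a.
    by move: hr; rewrite -/h mulrDr mulrDl => hr' _; lra.
  by rewrite ler_norml.
have K00 : 0 <= K0 by rewrite mulr_ge0// sqr_ge0.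
have K10 : 0 <= K1.
  by rewrite mulr_ge0 ?(ltW h0)// mulr_ge0 ?sqr_ge0// mulr_ge0//; lra.
have K20 : 0 <= K2 by rewrite mulr_ge0 ?sqr_ge0// mulr_ge0.
pose w (x : R) := expR (1 * (x / r)) + expR (- (1 * (x / r))).
have gE x : g x + g (- x) = K0 + K1 * (x / r) ^+ 2 + s ^+ 4 * h ^+ 2 / 2 * (x / r) ^+ 4.
  by rewrite /g /milstein_factor /K0 /K1 /h; field; rewrite gt_eqF.
(* The quartic term is enclosed between 0 and a multiple of cosh; both ends are within the tolerated
   order h^2. *)
have lowpt x : K0 + K1 * (x / r) ^+ 2 + 0 * w x <= g x + g (- x).
  rewrite gE mul0r addr0 lerDl mulr_ge0 ?exprn_even_ge0//.
  by rewrite divr_ge0// mulr_ge0// sqr_ge0.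
have uppt x : g x + g (- x) <= K0 + K1 * (x / r) ^+ 2 + K2 * w x.
  rewrite gE lerD2l /K2 /w; move: (x / r) => z.
  have z4 : z ^+ 4 <= 24 * (expR (1 * z) + expR (- (1 * z))).
    rewrite mul1r; have := @exprn_le_expR R `|z| 4 (normr_ge0 _).
    rewrite -normrX ger0_norm ?exprn_even_ge0// => /le_trans; apply.
    by rewrite ler_pM2l// expR_norm_le.
  have := ler_wpM2l (_ : 0 <= s ^+ 4 * h ^+ 2 / 2) z4.
  move=> H; apply: (le_trans (H _)); first by rewrite divr_ge0// mulr_ge0// sqr_ge0.
  by rewrite le_eqVlt; apply/orP; left; apply/eqP; field.
have mup (K : R) : measurable_fun setT (fun x : R => K0 + K1 * (x / r) ^+ 2 + K * w x).
  exact: measurable_quadratic_cosh.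
have mgg : measurable_fun setT (fun x : R => g x + g (- x)).
  by apply: measurable_funD => //; exact: measurableT_comp.
have low : ((K0 + K1)%:E <= 2%:E * I)%E.
  rewrite -integral_normal_symmetrize//.
  have -> : K0 + K1 = K0 + K1 + 0 * (2 * expR (1 ^+ 2 / 2)) by rewrite mul0r addr0.
  rewrite -(@integral_normal_quadratic_cosh _ r)//; apply: ge0_le_integral => //.
  - by move=> x _; rewrite lee_fin mul0r addr0 addr_ge0// mulr_ge0// sqr_ge0.
  - by apply/measurable_EFinP; exact: mup.
  - exact/measurable_EFinP.
  - by move=> x _; rewrite lee_fin.
have up : (2%:E * I <= (K0 + K1 + K2 * (2 * expR (1 ^+ 2 / 2)))%:E)%E.
  rewrite -integral_normal_symmetrize// -(@integral_normal_quadratic_cosh _ r)//.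
  apply: ge0_le_integral => //.
  - by move=> x _; rewrite lee_fin addr_ge0.
  - exact/measurable_EFinP.
  - by apply/measurable_EFinP; exact: mup.
  - by move=> x _; rewrite lee_fin.
have I0 : (0 <= I)%E by apply: integral_ge0 => x _; rewrite lee_fin.
have Ifin : I \is a fin_num.
  rewrite ge0_fin_numE//; move: up; case: (I) I0 => [?| |]//=; first by rewrite ltry.
  by rewrite mulry gtr0_sg// mul1e.
exists (fine I); last by rewrite fineK.
move: low up; rewrite -(fineK Ifin); set m := fine I.
rewrite -EFinM !lee_fin expr1n => low up.
have h20 : 0 <= h ^+ 2 by rewrite sqr_ge0.
have K01 : K0 + K1 = 2 * (1 + 2 * b * h + (a ^+ 2 + a * s ^+ 2) * h ^+ 2).
  by rewrite /K0 /K1 /b; ring.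
have c0 : 0 <= 12 * expR (1 / 2) * s ^+ 4 * h ^+ 2.
  by do 3?rewrite mulr_ge0//; exact: sqr_ge0.
have m1 : 1 + 2 * b * h - k * h ^+ 2 <= m.
  have := ler_wpM2r h20 (ler_norm (- (a ^+ 2 + a * s ^+ 2))).
  by move: low; rewrite K01 normrN mulNr /k mulrDl; lra.
have m2 : m <= 1 + 2 * b * h + k * h ^+ 2.
  have := ler_wpM2r h20 (ler_norm (a ^+ 2 + a * s ^+ 2)).
  have : K2 * (2 * expR (1 / 2)) = 2 * (12 * expR (1 / 2) * s ^+ 4 * h ^+ 2).
    by rewrite /K2; ring.
  by move: up; rewrite K01 /k mulrDl => up' e; rewrite e in up'; lra.
have m3 : 1 / 2 <= m.
  have : (3 / 4) ^+ 2 <= (1 + a * h) ^+ 2 by rewrite ler_sqr ?nnegrE; lra.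
  by move: low K10; rewrite /K0; lra.
apply/andP; split; last first.
  apply: (le_trans m2); apply: (le_trans _ (expR_ge1Dx _)).
  have kh : 0 <= k * h ^+ 2 by rewrite mulr_ge0.
  have Ch := mulr_ge0 C0 h20.
  rewrite [X in _ <= 1 + X](_ : _ = 2 * b * h + 2 * h ^+ 2 + 2 * (k * h ^+ 2) +
    2 * ((2 * `|b| + k) ^+ 2 * h ^+ 2)); last by rewrite /b; ring.
  lra.
(* This is 1/m <= e^(1/m - 1) inverted. Its exponent is then bounded below by m - 1 - 2 (m - 1)^2,
   using 1/m <= 2. *)
have v : expR (1 - m^-1) <= m.
  have := expR_ge1Dx (m^-1 - 1); rewrite addrCA subrr addr0 -opprB expRN.
  by rewrite lef_pV2 ?posrE ?expR_gt0//; lra.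
apply: le_trans v; rewrite ler_expR.
have y2 : (m - 1) ^+ 2 <= (2 * `|b| + k) ^+ 2 * h ^+ 2.
  rewrite -exprMn -(real_normK (num_real (m - 1))) ler_sqr ?nnegrE//; last first.
    by rewrite mulr_ge0 ?(ltW h0)// addr_ge0// mulr_ge0.
  have bh : `|b * h| = `|b| * h by rewrite normrM (gtr0_norm h0).
  have kh : k * h ^+ 2 <= k * h by rewrite ler_wpM2l// expr2 ler_piMl// ltW.
  have := ler_norm (b * h); have := ler_norm (- (b * h)); rewrite normrN bh.
  by rewrite ler_norml => b1 b2; apply/andP; split; lra.
have ym : m - 1 - 2 * (m - 1) ^+ 2 <= 1 - m^-1.
  have mi : m^-1 <= 2 by rewrite -[leRHS]invrK lef_pV2 ?posrE ?invr_gt0//; lra.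
  have -> : 1 - m^-1 = m - 1 - (m - 1) ^+ 2 * m^-1 by field; rewrite gt_eqF//; lra.
  by have := ler_wpM2l (sqr_ge0 (m - 1)) mi; lra.
apply: le_trans ym.
have kh : 0 <= k * h ^+ 2 by rewrite mulr_ge0.
rewrite [leLHS](_ : _ = 2 * b * h - 2 * h ^+ 2 - 2 * (k * h ^+ 2) -
    2 * ((2 * `|b| + k) ^+ 2 * h ^+ 2)); last by rewrite /b; ring.
lra.
Qed.

(** * Growth of the scheme *)

Lemma le_limn_esup (R : realType) (u v : (\bar R)^nat) :
  (\forall n \near \oo, (u n <= v n)%E) -> (limn_esup u <= limn_esup v)%E.
Proof.
move=> [N _ uv]; rewrite !limn_esup_lim.
apply: lee_lim; [exact: is_cvg_esups|exact: is_cvg_esups|].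
exists N => // n /= Nn; apply: ge_ereal_sup => _ [m /= nm <-].
apply: (le_trans (uv m _)); first by rewrite /= (leq_trans Nn).
by apply: ereal_sup_ubound; exists m.
Qed.

(** A constant prefactor [c] contributes ln c / t_n, which vanishes in the limit, so only the rate
    [g] survives. *)
Lemma limn_esup_grid (R : realType) (dt c g : R) : 0 < dt ->
  limn_esup (fun n => ((grid_time dt n)^-1 * (ln c + g * grid_time dt n))%:E) = g%:E.
Proof.
move=> dt0; set u := fun n => _.
suff cu : u @ \oo --> g%:E by have [_ ->] := cvg_limn_einf_sup cu.
(* The shift skips [n = 0], where the grid time vanishes and the identity with the harmonic sequence
   would fail. *)
rewrite -cvg_shiftS; apply/cvg_EFin; first exact: nearW.
rewrite [X in X @ _ --> _](_ : _ = fun n => harmonic n * (ln c / dt) + g); last first.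
  apply/funext => n; rewrite /= /grid_time /harmonic; field.
  by rewrite gt_eqF//= pnatr_eq0.
rewrite -[X in _ --> X]add0r -[X in _ --> X + _](mul0r (ln c / dt)).
apply: cvgD; last exact: cvg_cst.
by apply: cvgM; [exact: cvg_harmonic|exact: cvg_cst].
Qed.

Lemma grid_time_gt0 (R : realType) (dt : R) n : 0 < dt -> (0 < n)%N -> 0 < grid_time dt n.
Proof. by move=> dt0 n0; rewrite mulr_gt0 ?ltr0n. Qed.

Lemma limn_esup_lne_le (R : realType) (dt c g : R) (x : (\bar R)^nat) :
  0 < dt -> 0 < c ->
  (\forall n \near \oo, (0 <= x n <= (c * expR (g * grid_time dt n))%:E)%E) ->
  (limn_esup (fun n => ((grid_time dt n)^-1)%:E * lne (x n)) <= g%:E)%E.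
Proof.
move=> dt0 c0 xle; rewrite -(limn_esup_grid c g dt0); apply: le_limn_esup.
near=> n; have /andP[x0 xn] : (0 <= x n <= (c * expR (g * grid_time dt n))%:E)%E by near: n.
have n0 : (0 < n)%N by near: n; exists 1%N.
rewrite EFinM lee_pmul2l ?lte_fin ?invr_gt0 ?grid_time_gt0//.
have -> : (ln c + g * grid_time dt n)%:E = lne (c * expR (g * grid_time dt n))%:E.
  by rewrite lne_EFin ?mulr_gt0 ?expR_gt0// lnM ?posrE ?expR_gt0// expRK.
by rewrite lee_lne// in_itv/= ?leey ?andbT// lee_fin mulr_ge0 ?expR_ge0 ?(ltW c0).
Unshelve. all: by end_near. Qed.

Lemma limn_esup_lne_ge (R : realType) (dt c g : R) (x : (\bar R)^nat) :
  0 < dt -> 0 < c ->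
  (\forall n \near \oo, ((c * expR (g * grid_time dt n))%:E <= x n)%E) ->
  (g%:E <= limn_esup (fun n => ((grid_time dt n)^-1)%:E * lne (x n)))%E.
Proof.
move=> dt0 c0 xle; rewrite -(limn_esup_grid c g dt0); apply: le_limn_esup.
near=> n; have xn : ((c * expR (g * grid_time dt n))%:E <= x n)%E by near: n.
have n0 : (0 < n)%N by near: n; exists 1%N.
have e0 : 0 <= c * expR (g * grid_time dt n) by rewrite mulr_ge0 ?expR_ge0 ?(ltW c0).
rewrite EFinM lee_pmul2l ?lte_fin ?invr_gt0 ?grid_time_gt0//.
have -> : (ln c + g * grid_time dt n)%:E = lne (c * expR (g * grid_time dt n))%:E.
  by rewrite lne_EFin ?mulr_gt0 ?expR_gt0// lnM ?posrE ?expR_gt0// expRK.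
rewrite lee_lne// in_itv/= leey ?andbT ?lee_fin//.
by apply: le_trans xn; rewrite lee_fin.
Unshelve. all: by end_near. Qed.

Section scheme.
Context d (T : measurableType d) (R : realType) (P : probability T R) (B : R -> T -> R).
Context (brownian : is_brownian P B) (a s dt : R) (dt0 : 0 < dt).
Local Notation N := (normal_prob 0 (Num.sqrt dt)).
Local Notation F i w := (milstein_factor a s dt (bm_incr B dt i w)).

Lemma measurable_bm_incr i : measurable_fun setT (bm_incr B dt i).
Proof. by case: brownian => mB _ _ _ _; exact: measurable_funB. Qed.

Lemma bm_incr_iid (n : nat) (D : nat -> set R) : (forall i, measurable (D i)) ->
  P (\bigcap_(i in [set i | (i < n)%N]) (bm_incr B dt i @^-1` D i)) =
  (\prod_(i < n) N (D i))%E.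
Proof.
move=> mD; case: brownian => _ _ _ normalB indepB.
have preE (f : T -> R) (A : set R) : [set w | f w \in A] = f @^-1` A.
  by apply/funext => w /=; apply/propext; rewrite in_setE.
have step i : grid_time dt i.+1 - grid_time dt i = dt.
  by rewrite /grid_time -mulrBl -natrB// subSnn mul1r.
have grid_lt i : grid_time dt i < grid_time dt i.+1 by rewrite -subr_gt0 step.
have := indepB n (grid_time dt) _ (fun i _ => grid_lt i) D mD.
under eq_bigcapr do rewrite preE.
move=> ->; last by rewrite /grid_time mul0r.
apply: eq_bigr => i _; rewrite normalB ?step//.
by rewrite /grid_time mulr_ge0// ltW.
Qed.

Lemma integral_bm_incr_prod (f : R -> R) (m : R) (n : nat) :
  measurable_fun setT f -> (forall x, 0 <= f x) ->
  (\int[N]_x (f x)%:E = m%:E)%E ->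
  (\int[P]_w (\prod_(i < n) f (bm_incr B dt i w))%:E = (m ^+ n)%:E)%E.
Proof.
move=> mf f0 fm; apply: integral_prod_iid fm => //.
- exact: measurable_bm_incr.
- exact: bm_incr_iid.
Qed.

Lemma milstein_rhoE (lam eps x0 y0 : R) n w : a = lam + eps ^+ 2 / 2 - s ^+ 2 / 2 ->
  milstein_rho lam eps s x0 y0 dt B n w =
  Num.sqrt (x0 ^+ 2 + y0 ^+ 2) * \prod_(i < n) F i w.
Proof.
move=> aE; elim: n => [|n IH]; first by rewrite big_ord0 mulr1.
rewrite big_ord_recr [LHS]/= IH [RHS]mulrA; congr (_ * _).
by rewrite /milstein_factor aE.
Qed.

(** Independence gives the exact value rho0^2 m^n of the second moment, so the bounds hold at every
    [n]. The square root absorbs the factor 2 in the exponents. *)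
Lemma ms_norm_bounds (rho0 g1 g2 m : R) (X : nat -> T -> R) (n : nat) :
  0 <= rho0 -> (forall w, X n w = rho0 * \prod_(i < n) F i w) ->
  expR (2 * g1 * dt) <= m <= expR (2 * g2 * dt) ->
  (\int[N]_x (milstein_factor a s dt x ^+ 2)%:E = m%:E)%E ->
  ((rho0 * expR (g1 * grid_time dt n))%:E <= ms_norm P X n
    <= (rho0 * expR (g2 * grid_time dt n))%:E)%E.
Proof.
move=> r0 XE /andP[m1 m2] Fm.
have EX : ('E_P[fun w => (X n w ^+ 2)%R] = (rho0 ^+ 2 * m ^+ n)%:E)%E.
  rewrite unlock.
  rewrite EFinM -(@integral_bm_incr_prod (fun x => milstein_factor a s dt x ^+ 2) m)//; first last.
  - by move=> x; exact: sqr_ge0.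
  - by apply: measurable_funX; exact: measurable_milstein_factor.
  rewrite -ge0_integralZl ?lee_fin ?sqr_ge0//; first last.
  - by move=> w _; rewrite lee_fin prodr_ge0// => i _; exact: sqr_ge0.
  - apply/measurable_EFinP; apply: measurable_prod => i _; apply: measurable_funX.
    exact: (measurableT_comp (measurable_milstein_factor a s dt) (measurable_bm_incr i)).
  apply: eq_integral => w _; rewrite XE exprMn -EFinM; congr ((_ * _)%:E).
  by rewrite prodrXl.
have powE g : rho0 * expR (g * grid_time dt n) = Num.sqrt (rho0 ^+ 2 * expR (2 * g * dt) ^+ n).
  have -> : expR (2 * g * dt) ^+ n = expR (g * grid_time dt n) ^+ 2.
    rewrite -!expRM_natl; congr expR; rewrite /grid_time; ring.
  by rewrite -exprMn sqrtr_sqr ger0_norm// mulr_ge0 ?expR_ge0.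
rewrite /ms_norm EX /= !powE !lee_fin.
have m0 : 0 <= m by apply: le_trans m1; exact: expR_ge0.
by apply/andP; split; apply: ler_wsqrtr; apply: ler_wpM2l;
  rewrite ?sqr_ge0// lerXn2r ?nnegrE ?expR_ge0.
Qed.

(** [Y n] is the n-fold product of p-th powers normalized so that its mean is at most e^(-n e). The
    slack [e] makes these means summable, hence [Y] is almost surely bounded, and the logarithm of
    the bound is [c]. The sign of [p] decides whether the sum of logarithms is bounded above or
    below. *)
Lemma ae_exp_bound (p k m : R) :
  0 <= m <= expR k ->
  (\int[N]_x (expR (p * ln (milstein_factor a s dt x)))%:E = m%:E)%E ->
  forall e : R, 0 < e ->
  {ae P, forall w, exists c : R, forall n,
    p * \sum_(i < n) ln (F i w) <= c + n%:R * (k + e)}.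
Proof.
move=> /andP[m0 mk] Fm e e0.
pose Y n w := expR (- (n%:R * (k + e))) * \prod_(i < n) expR (p * ln (F i w)).
have mlnF := measurable_expR_ln_milstein_factor a s dt p.
have mprod n : measurable_fun setT (fun w => \prod_(i < n) expR (p * ln (F i w))).
  apply: measurable_prod => i _.
  exact: (measurableT_comp mlnF (measurable_bm_incr i)).
have : {ae P, forall w, exists C : R, 0 < C /\ forall n, Y n w <= C}.
  apply: (@ae_bounded_geometric _ _ _ P Y 1 (expR (- e))).
  - by move=> n; exact: measurable_funM.
  - by move=> n w; rewrite mulr_ge0 ?expR_ge0// prodr_ge0// => i _; exact: expR_ge0.
  - by rewrite expR_ge0 expR_lt1 oppr_lt0.
  - move=> n; under eq_integral do rewrite EFinM.
    rewrite ge0_integralZl ?lee_fin ?expR_ge0//; first last.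
    + by move=> w _; rewrite lee_fin prodr_ge0// => i _; exact: expR_ge0.
    + exact/measurable_EFinP.
    rewrite (@integral_bm_incr_prod (fun x => expR (p * ln (milstein_factor a s dt x))) m)//.
      rewrite -EFinM lee_fin mul1r -expRM_natl.
      apply: (@le_trans _ _ (expR (- (n%:R * (k + e))) * expR k ^+ n)).
        by rewrite ler_pM2l ?expR_gt0// lerXn2r ?nnegrE ?expR_ge0.
      by rewrite -expRM_natl -expRD ler_expR le_eqVlt; apply/orP; left; apply/eqP; ring.
apply: filterS => w [C [C0 YC]]; exists (ln C) => n.
have := YC n; rewrite /Y -expR_sum -mulr_sumr -expRD -{1}(lnK C0) ler_expR.
by rewrite addrC lerBlDr.
Qed.

Lemma ae_path_bounds (rho0 K : R) (X : nat -> T -> R) :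
  0 < rho0 -> (forall n w, X n w = rho0 * \prod_(i < n) F i w) ->
  4 * (`|a| + 1) * dt <= 1 ->
  (forall p : R, `|p| <= Num.sqrt dt -> exists2 m : R,
    0 <= m <= expR (p * a * dt + K * dt ^+ 2) &
    (\int[N]_x (expR (p * ln (milstein_factor a s dt x)))%:E = m%:E)%E) ->
  {ae P, forall w, exists2 c : R, 0 < c & forall n,
    c^-1 * expR ((a - (K + 1) * Num.sqrt dt) * grid_time dt n) <= X n w
      <= c * expR ((a + (K + 1) * Num.sqrt dt) * grid_time dt n)}.
Proof.
move=> rho00 XE hdt moments; set r := Num.sqrt dt in moments *.
have r0 : 0 < r by rewrite sqrtr_gt0.
have r2 : r ^+ 2 = dt by rewrite sqr_sqrtr// ltW.
have rr : `|r| <= r by rewrite gtr0_norm.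
have Nrr : `|- r| <= r by rewrite normrN gtr0_norm.
have F0 i w : 0 < F i w.
  apply: lt_le_trans (milstein_factor_ge s (bm_incr B dt i w) (ltW dt0) hdt); lra.
have prodE n w : \prod_(i < n) F i w = expR (\sum_(i < n) ln (F i w)).
  by rewrite expR_sum; apply: eq_bigr => i _; rewrite lnK ?posrE.
(* The slack is dt^2, the order of the moment error, whence [K + 1]. Dividing by p = r or -r turns n
   dt^2 into r t_n up to sign. *)
have [m1 m1K /ae_exp_bound - /(_ _ m1K _ (exprn_gt0 2 dt0)) up] := moments r rr.
have [m2 m2K /ae_exp_bound - /(_ _ m2K _ (exprn_gt0 2 dt0)) low] := moments (- r) Nrr.
move: up low; apply: filterS2 => w [c1 up] [c2 low].
(* One constant absorbs both random bounds and the initial value, so that [expR M] and its inverse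
   serve the two sides. *)
pose M := (`|c1| + `|c2|) / r + `|ln rho0|.
exists (expR M) => [|n]; first exact: expR_gt0.
rewrite -expRN -!expRD XE prodE -{1 2}(lnK rho00) -expRD !ler_expR.
have {}up := up n; have {}low := low n; set S := \sum_(i < n) _ in up low *.
have gridE : grid_time dt n = n%:R * dt by [].
rewrite gridE; set t := n%:R * dt.
have rn0 : r != 0 by rewrite gt_eqF.
have upS : S <= c1 / r + (a + (K + 1) * r) * t.
  rewrite -(ler_pM2l r0); apply: (le_trans up).
  by rewrite le_eqVlt; apply/orP; left; apply/eqP; rewrite /t -r2; field.
have lowS : - S <= c2 / r - (a - (K + 1) * r) * t.
  rewrite -(ler_pM2l r0) mulrN -mulNr; apply: (le_trans low).
  by rewrite le_eqVlt; apply/orP; left; apply/eqP; rewrite /t -r2; field.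
have cr1 : c1 / r <= `|c1| / r by rewrite ler_pM2r ?invr_gt0// ler_norm.
have cr2 : c2 / r <= `|c2| / r by rewrite ler_pM2r ?invr_gt0// ler_norm.
have p1 : 0 <= `|c1| / r by rewrite divr_ge0// ltW.
have p2 : 0 <= `|c2| / r by rewrite divr_ge0// ltW.
have := ler_norm (ln rho0); have := ler_norm (- ln rho0); rewrite normrN => n1 n2.
by rewrite /M mulrDl; apply/andP; split; lra.
Qed.

End scheme.

(** * Choice of the step size and the stability dichotomies *)

(** Below the threshold the discretization error is smaller than a nonzero rate [x], so it cannot
    change its sign. For [x = 0] no sign is claimed and any positive value will do. *)
Lemma step_size_threshold (R : realType) (c x : R) : 0 < c ->
  exists2 e : R, 0 < e & (x != 0 -> c * e <= `|x|).
Proof.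
move=> c0; have [->|x0] := eqVneq x 0; first by exists 1.
by exists (`|x| / c) => [|_]; [rewrite divr_gt0// normr_gt0|rewrite mulrC divfK// gt_eqF].
Qed.

Theorem theorem1p1 (R : realType) (lam eps sig : R) :
  exists dt1 C1 C2 : R,
  [/\ 0 < dt1 < 1, 0 < C1, 0 < C2 &
  forall x0 y0 : R, (x0, y0) != (0, 0) ->
  forall (d : measure_display) (T : measurableType d) (P : probability T R)
         (B : R -> T -> R),
  is_brownian P B ->
  forall dt : R, 0 < dt < dt1 ->
  [/\ ((lam + eps ^+ 2 / 2 + sig ^+ 2 / 2 - C1 * dt)%:E
         <= ms_lyapunov P (milstein_rho lam eps sig x0 y0 dt B) dt
         <= (lam + eps ^+ 2 / 2 + sig ^+ 2 / 2 + C1 * dt)%:E)%E,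
      {ae P, forall w,
        ((lam + eps ^+ 2 / 2 - sig ^+ 2 / 2 - C2 * Num.sqrt dt)%:E
         <= path_lyapunov (fun n => milstein_rho lam eps sig x0 y0 dt B n w) dt
         <= (lam + eps ^+ 2 / 2 - sig ^+ 2 / 2 + C2 * Num.sqrt dt)%:E)%E},
      (lam + eps ^+ 2 / 2 + sig ^+ 2 / 2 < 0 ->
         ms_exp_stable P (milstein_rho lam eps sig x0 y0 dt B) dt) /\
      (0 < lam + eps ^+ 2 / 2 + sig ^+ 2 / 2 ->
         ms_exp_blowup P (milstein_rho lam eps sig x0 y0 dt B) dt) &
      (lam + eps ^+ 2 / 2 - sig ^+ 2 / 2 < 0 ->
         as_exp_stable P (milstein_rho lam eps sig x0 y0 dt B) dt) /\
      (0 < lam + eps ^+ 2 / 2 - sig ^+ 2 / 2 ->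
         as_exp_blowup P (milstein_rho lam eps sig x0 y0 dt B) dt)]].
Proof.
set a := lam + eps ^+ 2 / 2 - sig ^+ 2 / 2.
have bE : lam + eps ^+ 2 / 2 + sig ^+ 2 / 2 = a + sig ^+ 2 by rewrite /a; field.
rewrite bE; set b := a + sig ^+ 2.
have [K K0 moment] := milstein_factor_moment a sig.
have [C1 C10 moment2] := milstein_factor_moment2 a sig.
have K10 : 0 < K + 1 by lra.
have [e1 e10 thr1] := step_size_threshold b C10.
have [e2 e20 thr2] := step_size_threshold a K10.
pose e0 := (4 * (`|a| + 1))^-1.
have A0 : 0 < 4 * (`|a| + 1) by have := normr_ge0 a; lra.
have e00 : 0 < e0 by rewrite invr_gt0.
have e01 : e0 < 1.
  by rewrite invf_lt1//; have := normr_ge0 a; lra.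
(* [e0] keeps the factor positive and the step below 1, and [e1] protects the sign of the
   mean-square rate. The third entry is squared because the almost sure error is linear in the
   square root of dt. *)
exists (Num.min e0 (Num.min e1 (e2 ^+ 2))), C1, (K + 1); split => //.
  by rewrite !lt_min e00 e10 exprn_gt0//= gt_min e01.
move=> x0 y0 xy0 d T P B brownian dt; rewrite !lt_min => /andP[dt0 /and3P[dte0 dte1 dte2]].
set X := milstein_rho _ _ _ _ _ _ _.
set r := Num.sqrt dt.
have r0 : 0 < r by rewrite sqrtr_gt0.
have r2 : r ^+ 2 = dt by rewrite sqr_sqrtr// ltW.
have hdt : 4 * (`|a| + 1) * dt <= 1.
  by rewrite -ler_pdivlMl// mulr1 ltW.
have r1 : 0 < r <= 1.
  by rewrite r0 -(ler_sqr (ltW r0) ler01) r2 expr1n ltW// (lt_trans dte0).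
have re2 : r < e2 by rewrite -ltr_sqr ?nnegrE ?ltW// r2.
set rho0 := Num.sqrt (x0 ^+ 2 + y0 ^+ 2).
have rho00 : 0 < rho0.
  rewrite sqrtr_gt0 lt0r addr_ge0 ?sqr_ge0// andbT paddr_eq0 ?sqr_ge0//.
  by rewrite !sqrf_eq0 -xpair_eqE.
have XE n w : X n w = rho0 * \prod_(i < n) milstein_factor a sig dt (bm_incr B dt i w).
  exact: milstein_rhoE.
have msX n : ((rho0 * expR ((b - C1 * dt) * grid_time dt n))%:E <= ms_norm P X n
    <= (rho0 * expR ((b + C1 * dt) * grid_time dt n))%:E)%E.
  have [m mE Fm] := moment2 r r1 (eq_ind_r (fun h => 4 * (`|a| + 1) * h <= 1) hdt r2).
  rewrite r2 in mE Fm.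
  exact: (ms_norm_bounds brownian dt0 (ltW rho00) (XE n) mE Fm).
have asX : {ae P, forall w, exists2 c : R, 0 < c & forall n,
    c^-1 * expR ((a - (K + 1) * r) * grid_time dt n) <= X n w
      <= c * expR ((a + (K + 1) * r) * grid_time dt n)}.
  apply: (ae_path_bounds brownian dt0 rho00 XE hdt) => p pr.
  have [m mE Fm] := moment r p r1 (eq_ind_r (fun h => 4 * (`|a| + 1) * h <= 1) hdt r2) pr.
  exists m; last by rewrite -Fm r2.
  by move: mE; rewrite r2 (_ : r ^+ 4 = dt ^+ 2)// -r2; ring.
have X0 n w : 0 <= X n w.
  rewrite XE mulr_ge0 ?(ltW rho00)// prodr_ge0// => i _.
  by apply: le_trans (milstein_factor_ge _ _ (ltW dt0) hdt); lra.
split.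
- apply/andP; split.
    apply: (limn_esup_lne_ge dt0 rho00); apply: nearW => n.
    by have /andP[] := msX n.
  apply: (limn_esup_lne_le dt0 rho00); apply: nearW => n.
  have /andP[lo ->] := msX n; rewrite andbT; apply: le_trans lo.
  by rewrite lee_fin mulr_ge0 ?expR_ge0 ?(ltW rho00).
- move: asX; apply: filterS => w [c c0 Xc]; apply/andP; split.
    have ci : 0 < c^-1 by rewrite invr_gt0.
    apply: (limn_esup_lne_ge dt0 ci); apply: nearW => n.
    by rewrite lee_fin ger0_norm//; have /andP[] := Xc n.
  apply: (limn_esup_lne_le dt0 c0); apply: nearW => n.
  by rewrite !lee_fin normr_ge0 ger0_norm//; have /andP[] := Xc n.
(* The dichotomies are read off the bounds valid for every [n]; a lower bound on the limsup would
   give blow-up only along a subsequence. *)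
- split=> b0.
    have C1b : C1 * dt < - b.
      by rewrite -ltr0_norm// (lt_le_trans _ (thr1 (negbT (lt_eqF b0))))// ltr_pM2l.
    exists rho0, (- (b + C1 * dt)); split => //; first lra.
    by apply: nearW => n; have /andP[_] := msX n; rewrite mulNr opprK.
  have C1b : C1 * dt < b.
    by rewrite -(gtr0_norm b0) (lt_le_trans _ (thr1 (negbT (gt_eqF b0))))// ltr_pM2l.
  exists rho0, (b - C1 * dt); split => //; first lra.
  by apply: nearW => n; have /andP[] := msX n.
- split=> a0.
    have C2a : (K + 1) * r < - a.
      by rewrite -ltr0_norm// (lt_le_trans _ (thr2 (negbT (lt_eqF a0))))// ltr_pM2l.
    exists (- (a + (K + 1) * r)); split; first lra.
    move: asX; apply: filterS => w [c c0 Xc]; exists c; split => //.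
    by apply: nearW => n; rewrite ger0_norm// mulNr opprK; have /andP[] := Xc n.
  have C2a : (K + 1) * r < a.
    by rewrite -(gtr0_norm a0) (lt_le_trans _ (thr2 (negbT (gt_eqF a0))))// ltr_pM2l.
  exists (a - (K + 1) * r); split; first lra.
  move: asX; apply: filterS => w [c c0 Xc]; exists c^-1; rewrite invr_gt0; split => //.
  by apply: nearW => n; rewrite ger0_norm//; have /andP[] := Xc n.
Qed.
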